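(* Let $q\ge 4$ be a prime power and let $n,k>0$ be integers with $\gcd(n,k,q-1)=1$. If $\gcd(k,q-1)>2q(\log\log q)/\log q$, then there exists $a\in\mathbb{F}_q^*$ such that $x^n(x^k+a)$ permutes $\mathbb{F}_q$. Further, letting $T$ denote the number of $a\in\mathbb{F}_q$ for which $x^n(x^k+a)$ permutes $\mathbb{F}_q$, and writing $r:=(q-1)/\gcd(k,q-1)$, we have \begin{align*} \frac{r!}{r^r}&\left(q+1-\sqrt{q}(r^{r+1}-2r^r-r^{r-1}+2) - (r+1)r^{r-1}\right) \le T \\ &\le \frac{r!}{r^r}\left(q+1+\sqrt{q}(r^{r+1}-2r^r-r^{r-1}+2)\right). \end{align*}
   Context: $\log$ denotes the natural logarithm. A polynomial $f\in\mathbb{F}_q[x]$ is said to permute $\mathbb{F}_q$ if the map $\alpha\mapsto f(\alpha)$ is a bijection $\mathbb{F}_q\to\mathbb{F}_q$. *)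

(* Defs.v *)
From HB Require Import structures.
From mathcomp Require Import all_boot all_order all_algebra.
From mathcomp Require Import boolp reals exp.

Set Implicit Arguments.
Unset Strict Implicit.
Unset Printing Implicit Defensive.

Import Order.TTheory GRing.Theory Num.Theory.
Local Open Scope ring_scope.

Definition permutes (F : finFieldType) (f : {poly F}) : Prop :=
  bijective (fun x : F => f.[x]).

Definition binomial_poly (F : finFieldType) (n k : nat) (a : F) : {poly F} :=
  'X^n * ('X^k + a%:P).

(* The count ranges over all of F, including a = 0. *)
Definition num_permuting (F : finFieldType) (n k : nat) : nat :=
  #|[set a : F | `[< permutes (binomial_poly n k a) >]]|.

(* Main.v *)
(* Put s = gcd(k, q - 1), r = (q - 1)/s and k = s k'.  Then x^n (x^k + a) permutes
   F_q iff y |-> y^n (y^k' + a)^s induces a permutation pi of the r-th roots of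
   unity.  For each of the r! permutations pi this prescribes the values
   (zeta + a)^s for all r-th roots of unity zeta, and expanding these conditions in
   characters of order r turns the number of such a into r^-r times a sum of r^r
   complete character sums.  The main term comes from the trivial character, and
   the other sums are bounded by Weil's theorem; when the characters multiply to
   the trivial one the point at infinity improves the bound by one.

   For Weil's bound, the L-function of the character sum is a polynomial of degree
   m - 1 (m being the number of nontrivial characters), so that the sums over
   the extensions of F_q are power sums of its reciprocal roots.  These roots have
   absolute value at most q^(1/2) as soon as the sums over F_{q^{2t}} are O(q^t),
   and this is what Stepanov's method gives.  Its auxiliary polynomial is nonzero
   because small-degree multiples of the powers f^(h e) are linearly independent
   modulo X^N, which follows from an Artin-type argument with the Frobenius map.

   For existence, the hypothesis on gcd(k, q - 1) forces log q > 4 and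
   2 r log log q < log q, hence (2 r)^(2 r) < q, which makes the lower bound for
   T larger than 1; so some nonzero a works. *)
Require Import Defs.
From HB Require Import structures.
From mathcomp Require Import all_boot all_order all_algebra all_fingroup all_solvable all_field.
From mathcomp Require Import zify ring lra.
From mathcomp Require Import boolp reals exp.

Set Implicit Arguments.
Unset Strict Implicit.
Unset Printing Implicit Defensive.

Import Order.TTheory GRing.Theory Num.Theory.
Local Open Scope ring_scope.

(** * Frobenius independence *)

(** Stepanov's step needs fields of square size Q = q0^2 with r dividing q0 - 1. Then h = (Q - 1)/r
    equals h' (q0 + 1), and since q0-th powers behave as constants under Hasse derivatives of order
    below q0, f^h can be differentiated as if it were f^h'. This is why only extensions of even
    degree 2t occur, with q0 = q^t. The constants must not depend on t, so the independence argument
    uses the Frobenius map of the fixed field F_q and not that of the large field. The method bounds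
    each fibre of x |-> f(x)^h only from above; but the fibres together miss nothing except the
    zeros of f, which yields the matching lower bounds. The constant r^(r+1) - 2 r^r - r^(r-1) + 2
    is twice the genus of the curve with equations y_j^r = c_j (zeta_j + a), and (r + 1) r^(r-1)
    bounds its points over the r finite branch points and over infinity. *)

Lemma exprBn_pchar (R : comNzRingType) (n : nat) (x y : R) :
  [pchar R].-nat n -> (x - y) ^+ n = x ^+ n - y ^+ n.
Proof. by move=> pn; apply/eqP; rewrite eq_sym subr_eq -exprDn_pchar ?subrK. Qed.

Lemma expr_sum_pchar (R : comNzRingType) (n : nat) (I : Type) (s : seq I)
    (P : pred I) (E : I -> R) :
  [pchar R].-nat n ->
  (\sum_(i <- s | P i) E i) ^+ n = \sum_(i <- s | P i) E i ^+ n.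
Proof.
move=> pn; have n_gt0 : (0 < n)%N by case/andP: pn.
elim/big_rec2: _ => [|i y x _ <-]; first by rewrite expr0n -[n]prednK.
by rewrite exprDn_pchar.
Qed.

(** For [n] a power of the characteristic the difference is the n-th power of [f - f.[a]]; so n-th
    powers are constant to order [n] at each point. *)
Lemma dvdp_XsubC_exp_pchar (K : fieldType) (n : nat) (f : {poly K}) (a : K) :
  [pchar K].-nat n -> ('X - a%:P) ^+ n %| f ^+ n - (f.[a] ^+ n)%:P.
Proof.
move=> pn; rewrite polyC_exp -exprBn_pchar; last first.
  by rewrite (eq_pnat _ (pchar_poly K)).
by apply: dvdp_exp2r; rewrite dvdp_XsubCl /root !hornerE subrr.
Qed.

Lemma dvdp_sum (K : fieldType) (I : Type) (s : seq I) (P : pred I)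
    (E : I -> {poly K}) (g : {poly K}) :
  (forall i, P i -> g %| E i) -> g %| \sum_(i <- s | P i) E i.
Proof.
move=> gE; elim/big_ind: _ => //.
by move=> u v gu gv; rewrite dvdp_addr.
Qed.

Lemma size_mul_le (R : nzSemiRingType) (u v : {poly R}) m n :
  (size u <= m -> (size v).-1 <= n -> size (u * v)%R <= m + n)%N.
Proof. by move=> um vn; apply: leq_trans (size_polyMleq _ _) _; lia. Qed.

Lemma mupX (K : fieldType) (b : K) (g : {poly K}) n :
  g != 0 -> mup b (g ^+ n) = (mup b g * n)%N.
Proof.
move=> g0; elim: n => [|n IHn].
  by rewrite muln0 mupNroot // expr0 /root hornerE oner_eq0.
by rewrite exprS mupM ?expf_neq0 // IHn mulnS.
Qed.

(** Serves to compare multiplicities at a root [b] of [f], with [u = mup b f]: modulo [r] the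
    contributions [m0], [m1] of the coefficients drop out. *)
Lemma dvdn_balance (r d m0 m1 u e e0 : nat) :
  (r * m1 + (d.-1 - e) * u = r * m0 + (d.-1 - e0) * u ->
   e < e0 -> e0 < d -> r %| (e0 - e) * u)%N.
Proof.
move=> eqm lte ltd; apply/dvdnP; exists (m0 - m1)%N; rewrite mulnBl.
move: eqm; have -> : (d.-1 - e = d.-1 - e0 + (e0 - e))%N by lia.
by nia.
Qed.

(* A Frobenius version of Artin's argument on the linear independence of
   characters: raising a shortest relation to the power q yields another
   relation with the same support. *)
Lemma frobenius_independence (K : fieldType) (f : {poly K})
    (q h0 r Q h d N : nat) :
    [pchar K].-nat q -> q = (r * h0).+1 ->
    [pchar K].-nat Q -> Q = (r * h).+1 -> (N <= Q)%N -> (0 < h0)%N ->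
    f.[0] != 0 ->
    (forall e, (0 < e < d)%N -> exists b, ~~ (r %| e * mup b f)%N) ->
  forall n (k : 'I_d -> {poly K}) D,
    (#|[set e | k e != 0%R]| <= n)%N ->
    (forall e, size (k e) <= D)%N ->
    (D * (1 + q + h0 * d * size f) ^ n <= N)%N ->
    'X^N %| \sum_e k e * f ^+ (h * e) ->
  forall e, k e = 0.
Proof.
move=> pq qE pQ QE leNQ h0_gt0 f0 fmul.
have f_neq0 : f != 0 by apply: contraNneq f0 => ->; rewrite horner0.
(* Each elimination step multiplies the bound on the coefficient sizes by [B]. *)
set B := (1 + q + _)%N.
elim=> [|n IHn] k D suppk szk DB relk.
  move=> e; apply/eqP; apply: contraTT suppk => ke.
  by rewrite -ltnNge card_gt0; apply/set0Pn; exists e; rewrite inE.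
have [/existsP[e0 ke0]|] := boolP [exists e, k e != 0]; last first.
  by rewrite negb_exists => /forallP k0 e; apply/eqP; rewrite -[_ == _]negbK k0.
(* Modulo ['X^N] the power [f ^+ Q] is the constant [c]. As [q h e = h e + h0 e (Q - 1)], the q-th
   power of [f ^+ (h * e)] is [f ^+ (h * e)] times [c ^+ (h0 * e)] over [f ^+ (h0 * e)]; multiplying
   by [f ^+ (h0 * d.-1)] clears denominators and gives [w]. *)
pose c := f.[0] ^+ Q.
have c0 : c != 0 by rewrite expf_neq0.
pose w (e : 'I_d) := f ^+ (h0 * (d.-1 - e)) * (c ^+ (h0 * e))%:P.
have w0 e : w e != 0.
  by rewrite mulf_neq0 ?expf_neq0 // polyC_eq0 expf_neq0.
have relq : 'X^N %| \sum_e k e ^+ q * w e * f ^+ (h * e).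
  have : 'X^N %| f ^+ (h0 * d.-1) * (\sum_e k e * f ^+ (h * e)) ^+ q.
    by rewrite dvdp_mull // qE exprS dvdp_mulr.
  rewrite expr_sum_pchar; last by rewrite (eq_pnat _ (pchar_poly K)).
  rewrite mulr_sumr => relN; rewrite -(dvdp_subr _ relN) -sumrB.
  apply: dvdp_sum => e _.
  have -> : f ^+ (h0 * d.-1) * (k e * f ^+ (h * e)) ^+ q
     = k e ^+ q * f ^+ (h0 * (d.-1 - e)) * f ^+ (h * e) * (f ^+ Q) ^+ (h0 * e).
    rewrite exprMn mulrCA -!mulrA; congr (_ * _).
    rewrite -!exprM -!exprD; congr (_ ^+ _).
    have := ltn_ord e; have -> : (d.-1 = d.-1 - e + e)%N by have := ltn_ord e; lia.
    by rewrite QE qE => _; nia.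
  rewrite /w [X in _ - X](_ : _ = k e ^+ q * f ^+ (h0 * (d.-1 - e))
     * f ^+ (h * e) * (c ^+ (h0 * e))%:P); last first.
    by rewrite -!mulrA; congr (_ * (_ * _)); rewrite mulrC.
  rewrite -mulrBr dvdp_mull // polyC_exp subrXX dvdp_mulr //.
  apply: dvdp_trans (dvdp_XsubC_exp_pchar f 0 pQ).
  by rewrite subr0 dvdp_exp2l.
(* Eliminating [e0] between the relation and its q-th power shrinks the support, so by induction the
   two relations are proportional. *)
pose k' e := k e0 * (k e ^+ q * w e) - k e * (k e0 ^+ q * w e0).
have k'0 : forall e, k' e = 0.
  apply: (IHn k' (D * B)%N).
  - rewrite -ltnS; apply: leq_trans suppk; apply: proper_card.
    apply/properP; split; last first.
      by exists e0; rewrite !inE ?ke0 // /k' subrr eqxx.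
    apply/subsetP => e'; rewrite !inE; apply: contraNneq => ke'.
    by rewrite /k' ke' expr0n qE /= !(mul0r, mulr0) subrr.
  - move=> e'.
    have szw e1 e2 : (size (k e1 * (k e2 ^+ q * w e2))%R <= D * B)%N.
      have D_gt0 : (0 < D)%N.
        by apply: leq_trans (szk e0); rewrite size_poly_gt0.
      have szkq : ((size (k e2 ^+ q)%R).-1 <= D * q)%N.
        by rewrite size_exp leq_mul2r (leq_trans (leq_pred _) (szk _)) orbT.
      have szw : ((size (w e2)).-1 <= h0 * d * size f)%N.
        rewrite /w mulrC mul_polyC size_scale ?expf_neq0 // size_exp.
        rewrite [X in (X <= _)%N]mulnC -!mulnA; apply: leq_mul => //.
        by apply: leq_mul; [lia | exact: leq_pred].
      have := size_polyMleq (k e2 ^+ q) (w e2).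
      have := size_mul_le (szk e1) (leqnn (size (k e2 ^+ q * w e2)%R).-1).
      rewrite /B; nia.
    by rewrite (leq_trans (size_polyD _ _)) // size_polyN geq_max !szw.
  - by rewrite -mulnA -expnS.
  - rewrite [X in _ %| X](_ : _ = k e0 * (\sum_e k e ^+ q * w e * f ^+ (h * e))
       - k e0 ^+ q * w e0 * (\sum_e k e * f ^+ (h * e))).
      by rewrite dvdp_sub // dvdp_mull.
    rewrite !mulr_sumr -sumrB; apply: eq_bigr => i _.
    by rewrite /k'; move: (w i) (w e0) => wi w1; ring.
have ke e : e != e0 -> k e = 0.
  move=> ee0; apply/eqP; apply/negPn/negP => ke.
  (* Proportionality leaves [k e ^+ (r * h0) * w e = k e0 ^+ (r * h0) * w e0]; the multiplicities at
     a root supplied by [fmul] contradict this. *)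
  have := k'0 e; rewrite /k' qE !exprS => /eqP.
  rewrite -!mulrA [k e * (k e0 * _)]mulrCA -!mulrBr !mulf_eq0 (negPf ke) (negPf ke0) /=.
  rewrite subr_eq0 => /eqP eqw.
  have mw (i : 'I_d) b : k i != 0 -> mup b (k i ^+ (r * h0) * w i) =
      (mup b (k i) * (r * h0) + mup b f * (h0 * (d.-1 - i)))%N.
    move=> ki0; rewrite mupM ?expf_neq0 // /w mupM ?expf_neq0 ?polyC_eq0 ?expf_neq0 //.
    rewrite !mupX // [mup b _%:P]mupNroot ?addn0 //.
    by rewrite /root hornerC expf_neq0.
  have key b : (r * mup b (k e) + (d.-1 - e) * mup b f
              = r * mup b (k e0) + (d.-1 - e0) * mup b f)%N.
    have := congr1 (mup b) eqw; rewrite !mw // => eqm.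
    apply/eqP; rewrite -(eqn_pmul2r h0_gt0); apply/eqP.
    move: eqm; move: (d.-1 - e)%N (d.-1 - e0)%N (mup _ _) (mup _ _) (mup _ _).
    by clear=> *; lia.
  have : nat_of_ord e <> e0 by move/val_inj/eqP; rewrite (negPf ee0).
  case: (ltngtP e e0) => // lte _.
    have [|b /negP[]] := fmul (e0 - e)%N.
      by rewrite subn_gt0 lte (leq_ltn_trans (leq_subr _ _)).
    exact: dvdn_balance (key b) lte (ltn_ord e0).
  have [|b /negP[]] := fmul (e - e0)%N.
    by rewrite subn_gt0 lte (leq_ltn_trans (leq_subr _ _)).
  exact: dvdn_balance (esym (key b)) lte (ltn_ord e).
move=> e; case: (eqVneq e e0) => [->|/ke //]; apply/eqP.
move: relk; rewrite (bigD1 e0) //= big1 => [|i /ke ->]; last by rewrite mul0r.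
rewrite addr0 Gauss_dvdpl; last first.
  apply: coprimep_expl; apply: coprimep_expr; rewrite coprimep_sym coprimepX.
  exact: f0.
apply: contraTT => k0; apply/negP => /(dvdp_leq k0); rewrite size_polyXn.
have B_gt0 : (0 < B ^ n.+1)%N by rewrite expn_gt0 /B.
by rewrite ltnNge (leq_trans (szk e0)) // (leq_trans _ DB) // leq_pmulr.
Qed.

(** * Stepanov's method *)

Lemma dvdp_prod_XsubC_exp (K : fieldType) (R : {poly K}) (M : nat) (s : seq K) :
  uniq s -> {in s, forall a, ('X - a%:P) ^+ M %| R} ->
  \prod_(a <- s) ('X - a%:P) ^+ M %| R.
Proof.
elim: s => [|a s IHs] /=; first by rewrite big_nil dvd1p.
case/andP=> as_ us aR; rewrite big_cons Gauss_dvdp.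
  rewrite aR ?mem_head //= IHs // => b bs.
  by apply: aR; rewrite in_cons bs orbT.
apply: coprimep_expl; rewrite coprimep_sym coprimep_XsubC /root horner_prod.
rewrite prodf_seq_neq0; apply/allP => b bs /=.
rewrite horner_exp !hornerE expf_neq0 // subr_eq0.
by apply: contraNneq as_ => ->.
Qed.

Lemma size_gt_of_dvdp_XsubC_exp (K : fieldType) (R : {poly K}) (M : nat)
    (s : seq K) :
  uniq s -> R != 0 -> {in s, forall a, ('X - a%:P) ^+ M %| R} ->
  (size s * M < size R)%N.
Proof.
move=> us R0 /(dvdp_prod_XsubC_exp us); rewrite prodrXl => /(dvdp_leq R0).
have := size_exp (\prod_(a <- s) ('X - a%:P)) M.
rewrite size_prod_XsubC /= => <- /(leq_trans _); apply; rewrite prednK //.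
by rewrite size_poly_gt0 expf_neq0 // monic_neq0 // monic_prod_XsubC.
Qed.

(** Taylor expansion at [a]. Hasse derivatives, unlike iterated ones, detect multiplicities beyond
    the characteristic. *)
Lemma dvdp_XsubC_exp_nderivn (K : fieldType) (g : {poly K}) (a : K) M :
  (forall l, (l < M)%N -> (g^`N(l)).[a] = 0) -> ('X - a%:P) ^+ M %| g.
Proof.
move=> gM; have -> : g = \sum_(i < size g) (g^`N(i)).[a] *: ('X - a%:P) ^+ i.
  have := nderiv_taylor (map_poly polyC g) (mulrC a%:P ('X - a%:P)).
  rewrite addrC subrK -[LHS]/(g \Po 'X) comp_polyXr size_map_polyC => {1}->.
  by apply: eq_bigr => i _; rewrite nderivn_map horner_map /= mul_polyC.
apply: dvdp_sum => i _; case: (ltnP i M) => [iM | Mi].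
  by rewrite gM // scale0r dvdp0.
by rewrite -mul_polyC dvdp_mull // dvdp_exp2l.
Qed.

Lemma nderivn_polyCM (R : nzSemiRingType) n (c : R) (p : {poly R}) :
  (c%:P * p)^`N(n) = c%:P * p^`N(n).
Proof. by apply/polyP => i; rewrite coef_nderivn !coefCM coef_nderivn mulrnAr. Qed.

Section StepanovPolynomial.

Variables (K : finFieldType) (f : {poly K}) (d J D : nat).

(* Here Q = r h + 1 is the size of the field.  At a point x with f(x)^h = z one
   may replace 'X^Q by 'X and f^h by z, which leaves a polynomial of degree
   about D. *)
Definition stepanov_poly (Q h : nat)
    (v : {ffun 'I_d * 'I_J -> 'rV[K]_D}) : {poly K} :=
  \sum_(j < J) (\sum_(e < d) rVpoly (v (e, j)) * f ^+ (h * e)) * 'X^(j * Q).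

(* The l-th Hasse derivative of the Stepanov polynomial at a point x with
   f(x)^h = z, up to the factor f(x)^(h' (d - 1)): if h = h' (q0 + 1) and
   l < q0 then all q0-th powers behave as constants under the derivative. *)
Definition stepanov_cond (z : K) (h' l : nat)
    (v : {ffun 'I_d * 'I_J -> 'rV[K]_D}) : {poly K} :=
  \sum_(j < J) \sum_(e < d)
    z ^+ e *: ((rVpoly (v (e, j)) * f ^+ (h' * e))^`N(l)
               * (f ^+ (h' * (d.-1 - e)) * 'X^j)).

Lemma stepanov_condB z h' l v1 v2 :
  stepanov_cond z h' l (v1 - v2)
  = stepanov_cond z h' l v1 - stepanov_cond z h' l v2.
Proof.
rewrite -sumrB; apply: eq_bigr => j _; rewrite -sumrB; apply: eq_bigr => e _.
by rewrite !ffunE raddfB /= mulrBl nderivnB mulrBl scalerBr.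
Qed.

Lemma size_nderivn_leq l (g : {poly K}) : (size g^`N(l) <= size g)%N.
Proof.
apply/leq_sizeP => i gi; rewrite coef_nderivn nth_default ?mul0rn //.
by rewrite (leq_trans gi) // leq_addl.
Qed.

Lemma size_expf_le n : ((size (f ^+ n)).-1 <= size f * n)%N.
Proof. by rewrite size_exp leq_mul2r leq_pred orbT. Qed.

Lemma size_stepanov_cond z h' l v :
  (size (stepanov_cond z h' l v) <= D + size f * (h' * d.-1) + J)%N.
Proof.
apply: (leq_trans (size_sum _ _ _)); apply/bigmax_leqP => j _.
apply: (leq_trans (size_sum _ _ _)); apply/bigmax_leqP => e _.
apply: (leq_trans (size_scale_leq _ _)).
have -> : (D + size f * (h' * d.-1) + J
    = D + size f * (h' * e) + (size f * (h' * (d.-1 - e)) + J))%N.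
  have lte := ltn_ord e; rewrite -[in LHS](@subnKC e d.-1); last by lia.
  by rewrite !mulnDr; lia.
apply: size_mul_le.
  apply: leq_trans (size_nderivn_leq _ _) _; apply: size_mul_le (size_expf_le _).
  exact: size_poly.
have := size_polyMleq (f ^+ (h' * (d.-1 - e))) 'X^j.
have := size_expf_le (h' * (d.-1 - e)); have := ltn_ord j.
by rewrite size_polyXn; lia.
Qed.

(** Pigeonhole: the [d * J * D] free coefficients outnumber the coefficients of the [M] conditions,
    so two choices of [v] give the same conditions, and their difference solves them. *)
Lemma stepanov_cond_solvable z h' M :
  (M * (D + size f * (h' * d.-1) + J) < d * J * D)%N ->
  exists2 v, v != 0 & forall l, (l < M)%N -> stepanov_cond z h' l v = 0.
Proof.
set E := (D + _ + J)%N => ltE.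
pose Phi v := [ffun l : 'I_M => poly_rV (stepanov_cond z h' l v) : 'rV[K]_E].
have : ~~ injectiveb Phi.
  apply/negP => /injectiveP/leq_card; apply/negP; rewrite -ltnNge.
  rewrite !card_ffun !card_mx card_prod !card_ord !mul1n -!expnM ltn_exp2l.
    by rewrite mulnC (mulnC D).
  exact: card_finNzRing_gt1.
case/injectivePn => v1 [v2 v12 /ffunP eqPhi].
exists (v1 - v2) => [|l ltl]; first by rewrite subr_eq0.
have := eqPhi (Ordinal ltl); rewrite !ffunE /= => /(congr1 rVpoly).
rewrite !poly_rV_K ?size_stepanov_cond // => eqc.
by rewrite stepanov_condB eqc subrr.
Qed.

Lemma dvdp_stepanov_poly (q0 Q h h' M : nat) (z a : K) v :
  [pchar K].-nat q0 -> (M <= q0)%N -> h = (h' * q0.+1)%N -> (0 < h)%N ->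
  (q0 <= Q)%N -> [pchar K].-nat Q -> a ^+ Q = a -> z != 0 -> f.[a] ^+ h = z ->
  (forall l, (l < M)%N -> stepanov_cond z h' l v = 0) ->
  ('X - a%:P) ^+ M %| stepanov_poly Q h v.
Proof.
move=> pq0 leM hE h_gt0 leQ pQ aQ z0 faz condv.
have fa0 : f.[a] != 0.
  by apply: contraNneq z0 => fa0; rewrite -faz fa0 expr0n -[h]prednK.
(* [G] is the Stepanov polynomial times [f.[a] ^+ (h' * d.-1)], with [f ^+ q0] and ['X^Q] frozen at
   their values at [a]; this changes nothing modulo [('X - a%:P) ^+ M], and its derivatives at [a]
   are the values of [stepanov_cond]. *)
pose G := \sum_(j < J) \sum_(e < d) rVpoly (v (e, j)) * f ^+ (h' * e)
   * (z ^+ e * f.[a] ^+ (h' * (d.-1 - e)) * a ^+ j)%:P.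
have dvdG : ('X - a%:P) ^+ M %| G.
  apply: dvdp_XsubC_exp_nderivn => l ltl.
  have := congr1 (horner^~ a) (condv l ltl); rewrite horner0 => <-.
  rewrite (raddf_sum (nderivn l)) /= horner_sum [RHS]horner_sum; apply: eq_bigr => j _.
  rewrite (raddf_sum (nderivn l)) /= horner_sum [RHS]horner_sum; apply: eq_bigr => e _.
  rewrite [_ * _%:P]mulrC nderivn_polyCM hornerCM.
  by rewrite hornerZ !hornerM horner_exp hornerXn; ring.
set c := f.[a] ^+ (h' * d.-1); have c0 : c != 0 by rewrite expf_neq0.
rewrite -(dvdpZr _ _ c0) -(dvdp_subl _ dvdG) /G /stepanov_poly scaler_sumr -sumrB.
apply: dvdp_sum => j _; rewrite mulr_suml scaler_sumr -sumrB.
apply: dvdp_sum => e _.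
have -> : z ^+ e * f.[a] ^+ (h' * (d.-1 - e)) * a ^+ j
    = c * ((f.[a] ^+ q0) ^+ (h' * e) * (a ^+ Q) ^+ j).
  rewrite -faz aQ mulrA /c -!exprM -!exprD; congr (_ ^+ _ * _).
  rewrite hE; have -> : (d.-1 = d.-1 - e + e)%N by have := ltn_ord e; lia.
  by rewrite addnK; lia.
have -> : rVpoly (v (e, j)) * f ^+ (h * e) * 'X^(j * Q)
    = rVpoly (v (e, j)) * f ^+ (h' * e) * ((f ^+ q0) ^+ (h' * e) * ('X^Q) ^+ j).
  rewrite -!mulrA; congr (_ * _); rewrite mulrA -!exprM -exprD [(j * Q)%N]mulnC.
  by congr (_ ^+ _ * _); rewrite hE; lia.
rewrite polyCM -mul_polyC mulrCA -!mulrBr dvdp_mull //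
  dvdp_mull // polyCM !polyC_exp.
set u := f ^+ q0; set u' := _%:P ^+ q0; set y := 'X^Q; set y' := a%:P ^+ Q.
have uu' : ('X - a%:P) ^+ M %| u - u'.
  apply: dvdp_trans (dvdp_exp2l _ leM) _; rewrite /u' -polyC_exp.
  exact: dvdp_XsubC_exp_pchar.
have yy' : ('X - a%:P) ^+ M %| y - y'.
  apply: dvdp_trans (dvdp_exp2l _ (leq_trans leM leQ)) _.
  have := dvdp_XsubC_exp_pchar 'X a pQ; rewrite hornerX polyC_exp.
  exact.
have -> : u ^+ (h' * e) * y ^+ j - u' ^+ (h' * e) * y' ^+ j
   = (u ^+ (h' * e) - u' ^+ (h' * e)) * y ^+ j + u' ^+ (h' * e) * (y ^+ j - y' ^+ j).
  by ring.
apply: dvdp_add; first by rewrite dvdp_mulr // subrXX dvdp_mulr.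
by rewrite dvdp_mull // subrXX dvdp_mulr.
Qed.

Lemma size_stepanov_poly Q h v :
  (size (stepanov_poly Q h v) <= D + size f * (h * d.-1) + J.-1 * Q)%N.
Proof.
apply: (leq_trans (size_sum _ _ _)); apply/bigmax_leqP => j _.
apply: size_mul_le; last first.
  by rewrite size_polyXn leq_mul2r; apply/orP; right; have := ltn_ord j; lia.
apply: (leq_trans (size_sum _ _ _)); apply/bigmax_leqP => e _.
apply: size_mul_le; first exact: size_poly.
apply: leq_trans (size_expf_le _) _; rewrite !leq_mul2l.
by apply/orP; right; apply/orP; right; have := ltn_ord e; lia.
Qed.

(** If the blocks below [j] vanish, dividing by ['X^(j * Q)] leaves block [j] as a relation modulo
    ['X^Q], which [frobenius_independence] makes trivial. *)
Lemma stepanov_poly_neq0 (q h0 r Q h : nat) v :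
    [pchar K].-nat q -> q = (r * h0).+1 ->
    [pchar K].-nat Q -> Q = (r * h).+1 -> (0 < h0)%N -> f.[0] != 0 ->
    (forall e, (0 < e < d)%N -> exists b, ~~ (r %| e * mup b f)%N) ->
    (D * (1 + q + h0 * d * size f) ^ d <= Q)%N ->
  v != 0 -> stepanov_poly Q h v != 0.
Proof.
move=> pq qE pQ QE h0_gt0 f0 fmul leD; apply: contraNneq => R0.
suff v0 n : forall (j : 'I_J) e, (j < n)%N -> rVpoly (v (e, j)) = 0.
  apply/eqP/ffunP => -[e j]; rewrite !ffunE.
  by apply: (can_inj (@rVpolyK _ _)); rewrite linear0 (v0 J).
elim: n => // n IHn j e; rewrite ltnS leq_eqVlt => /orP[/eqP jn|/IHn //].
apply: (frobenius_independence pq qE pQ QE (leqnn Q) h0_gt0 f0 fmul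
  (n := d) (k := fun e => rVpoly (v (e, j))) (D := D)) => //.
- by rewrite (leq_trans (max_card _)) // card_ord.
- by move=> e'; apply: size_poly.
have Xn0 : 'X^(j * Q) != 0 :> {poly K} by rewrite -size_poly_gt0 size_polyXn.
rewrite -(dvdp_mul2r _ _ Xn0) -exprD -mulSn.
move: R0; rewrite /stepanov_poly (bigD1 j) //= => /eqP.
rewrite addr_eq0 => /eqP ->; rewrite -[X in _ %| X]mulN1r dvdp_mull //.
apply: dvdp_sum => i ij; case: (ltnP i n) => [lti|lei].
  by rewrite big1 ?mul0r ?dvdp0 // => e' _; rewrite IHn // mul0r.
rewrite dvdp_mull // dvdp_exp2l // leq_mul2r; apply/orP; right.
by rewrite ltn_neqAle eq_sym -val_eqE /= in ij *; rewrite ij jn.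
Qed.

End StepanovPolynomial.

(** The growth of coefficient sizes over the [d] eliminations of [frobenius_independence]; the size
    of the extension field does not enter. *)
Definition stepanov_base (q h0 d sf : nat) : nat := (1 + q + h0 * d * sf) ^ d.

Definition stepanov_const (q h0 d sf : nat) : nat :=
  2 * stepanov_base q h0 d sf * sf.+1.

(** Dividing by [M] turns the excess [c * q0 ^ 2] into at most [2 * c * q0]. *)
Lemma stepanov_arith (A M q0 d c : nat) :
  (q0 <= 2 * M -> d * A * M < (M + c) * q0 ^ 2 ->
   d * A <= q0 ^ 2 + 2 * c * q0)%N.
Proof.
rewrite -mulnn => le_q0 ltA; rewrite leqNgt; apply/negP => ltd.
have := leq_mul (ltnW ltd) (leqnn M).
have := leq_mul (leqnn (c * q0)) le_q0.
by lia.
Qed.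

Lemma stepanov_bound (K : finFieldType) (f : {poly K}) (q h0 r q0 h h' d : nat)
    (z : K) :
    let c1 := stepanov_const q h0 d (size f) in
    [pchar K].-nat q -> q = (r * h0).+1 -> (0 < h0)%N ->
    [pchar K].-nat q0 -> q0 = (r * h').+1 ->
    #|K| = (q0 ^ 2)%N -> (q0 ^ 2)%N = (r * h).+1 -> (2 * (d + c1) <= q0)%N ->
    (0 < d <= r)%N -> f.[0] != 0 ->
    (forall e, (0 < e < d)%N -> exists b, ~~ (r %| e * mup b f)%N) ->
    z != 0 ->
  (d * #|[set x | f.[x] ^+ h == z]| <= q0 ^ 2 + 2 * (c1 + d * size f) * q0)%N.
Proof.
move=> c1 pq qE h0_gt0 pq0 q0E cardK hE q0_big /andP[d_gt0 dr] f0 fmul z0.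
have pQ : [pchar K].-nat (q0 ^ 2)%N by rewrite pnatX pq0.
pose Bd := stepanov_base q h0 d (size f).
have Bd_gt0 : (0 < Bd)%N by rewrite expn_gt0.
have c1E : c1 = (2 * Bd * (size f).+1)%N by [].
have sf_gt0 : (0 < size f)%N.
  by rewrite size_poly_gt0; apply: contraNneq f0 => ->; rewrite horner0.
have hh' : h = (h' * q0.+1)%N.
  have r_gt0 : (0 < r)%N by apply: leq_trans d_gt0 dr.
  by apply/eqP; rewrite -(eqn_pmul2l r_gt0); apply/eqP; nia.
have c1_gt0 : (0 < c1)%N by rewrite c1E; nia.
have h'_gt0 : (0 < h')%N by case: (h') q0E => // q01; nia.
(* [D] is as large as nonvanishing permits. With [d * J = M + c1], solvability asks that [c1 * D]
   exceed [M] times about [(size f).+1 * q0]; the factor 2 in [c1] makes up for rounding in [D]. The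
   hypothesis [2 * (d + c1) <= q0] ensures [q0 <= 2 * M]. *)
pose J := (q0 %/ d)%N; pose D := (q0 ^ 2 %/ Bd)%N.
have leJ : (d * J <= q0)%N by rewrite mulnC leq_divM.
have ltJ : (q0 < d * J + d)%N.
  by rewrite -mulnSr mulnC ltn_ceil.
have leD : (D * Bd <= q0 ^ 2)%N by rewrite leq_divM.
have ltD : (q0 ^ 2 < D * Bd + Bd)%N by rewrite -mulSnr ltn_ceil.
have D_gt0 : (0 < D)%N.
  rewrite divn_gt0 // -mulnn (leq_trans _ (leq_pmulr _ _)) // ?q0E // -q0E.
  apply: leq_trans (_ : (c1 <= q0)%N); last by clear -q0_big; lia.
  by rewrite c1E mulnAC leq_pmull.
pose M := (d * J - c1)%N.
have MJ : (d * J = M + c1)%N by rewrite /M subnK //; lia.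
have [v v0 condv] : exists2 v : {ffun 'I_d * 'I_J -> 'rV[K]_D},
    v != 0 & forall l, (l < M)%N -> stepanov_cond f z h' l v = 0.
  apply: stepanov_cond_solvable.
  have X_le : (size f * (h' * d.-1) + J <= (size f).+1 * q0)%N.
    rewrite mulSn addnC leq_add ?leq_div // leq_mul2l q0E leqW ?orbT // mulnC.
    by rewrite leq_mul2r (leq_trans (leq_pred _) dr) orbT.
  rewrite MJ mulnDl -addnA mulnDr ltn_add2l.
  apply: leq_ltn_trans (leq_mul (leqnn M) X_le) _.
  have ltM : (M < q0)%N by clear -MJ c1_gt0 leJ; lia.
  have leQ : (q0 * q0 <= 2 * Bd * D)%N.
    rewrite mulnn; have : (Bd <= D * Bd)%N by rewrite leq_pmull.
    by clear -ltD; lia.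
  apply: leq_trans (_ : (q0 * ((size f).+1 * q0) <= _)%N).
    by rewrite ltn_pmul2r // muln_gt0 /= (leq_ltn_trans _ ltM).
  have := leq_mul (leqnn (size f).+1) leQ.
  by rewrite c1E; clear; move: Bd D (size f) => *; lia.
set A := [set x | _].
have R0 : stepanov_poly f (q0 ^ 2) h v != 0.
  exact: (stepanov_poly_neq0 pq qE pQ hE).
have M_le : (M <= q0)%N by clear -MJ leJ; lia.
have q0Q : (q0 <= q0 ^ 2)%N by rewrite -mulnn leq_pmulr // q0E.
have h_gt0 : (0 < h)%N by rewrite hh' muln_gt0 h'_gt0.
have AR : {in enum A, forall a, ('X - a%:P) ^+ M %| stepanov_poly f (q0 ^ 2) h v}.
  move=> a; rewrite mem_enum inE => /eqP fa.
  apply: (dvdp_stepanov_poly pq0 M_le hh' h_gt0 q0Q pQ _ z0 fa condv).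
  by rewrite -cardK expf_card.
have := size_gt_of_dvdp_XsubC_exp (enum_uniq A) R0 AR.
rewrite -cardE => /leq_trans/(_ (size_stepanov_poly f (q0 ^ 2) h v)).
have hd : (h * d.-1 <= q0 ^ 2)%N.
  rewrite hE mulnC (leq_trans (leq_mul (leq_trans (leq_pred d) dr) (leqnn h))) //.
have J_gt0 : (0 < J)%N by rewrite divn_gt0 //; clear -q0_big; lia.
have DQ : (D <= q0 ^ 2)%N := leq_div _ _.
move=> ltA; apply: (stepanov_arith (M := M)).
  by clear -MJ q0_big ltJ; lia.
rewrite -mulnA; apply: leq_trans (_ : (d * ((size f + J) * q0 ^ 2) <= _)%N); last first.
  by rewrite mulnA leq_mul2r mulnDr MJ; apply/orP; right; clear; lia.
rewrite ltn_pmul2l //; apply: leq_trans ltA _.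
rewrite -(prednK J_gt0) addnS mulSn mulnDl addnA leq_add2r leq_add //.
by rewrite leq_mul2l hd orbT.
Qed.

(** * L-functions *)

Lemma bernoulli_ge (R : numDomainType) (y : R) n :
  0 <= y -> 1 + n%:R * y <= (1 + y) ^+ n.
Proof.
move=> y0; elim: n => [|n IHn]; first by rewrite mul0r addr0 expr0.
rewrite exprS; apply: le_trans (ler_wpM2l _ IHn); last by rewrite addr_ge0.
have -> : (1 + y) * (1 + n%:R * y) = 1 + n.+1%:R * y + n%:R * (y * y).
  by rewrite -natr1; ring.
by rewrite lerDl mulr_ge0 // mulr_ge0.
Qed.

Lemma exp_bounded_le1 (y c : algC) t0 :
  0 <= y -> (forall t, (t0 <= t)%N -> y ^+ t <= c) -> y <= 1.
Proof.
move=> y0 yt; rewrite real_leNgt ?ger0_real //; apply/negP => y1.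
have d0 : 0 < y - 1 by rewrite subr_gt0.
have c0 : 0 <= c by apply: le_trans (yt t0 (leqnn _)); rewrite exprn_ge0.
pose n := (t0 + Num.bound (c / (y - 1)))%N.
have := yt n (leq_addr _ _); apply/negP; rewrite -real_ltNge ?realX ?ger0_real //.
have -> : y = 1 + (y - 1) by rewrite addrC subrK.
apply: lt_le_trans (bernoulli_ge _ (ltW d0)).
rewrite -ltrBlDl (lt_trans (y := c)) ?gtrBl ?ltr01 //.
rewrite -ltr_pdivrMr // (lt_le_trans (archi_boundP _)) ?divr_ge0 ?(ltW d0) //.
by rewrite ler_nat leq_addl.
Qed.

(** A polynomial [p] vanishing at all other members of [s] combines consecutive power sums into a
    nonzero multiple of [x1 ^+ t], so no cancellation can hide a large [x1]. *)
Lemma power_sum_growth (s : seq algC) (rho c : algC) (t0 : nat) :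
  0 < rho ->
  (forall t, (t0 <= t)%N -> `|\sum_(x <- s) x ^+ t| <= c * rho ^+ t) ->
  {in s, forall x, `|x| <= rho}.
Proof.
move=> rho0 bnd x1 x1s.
pose p := \prod_(y <- undup s | y != x1) ('X - y%:P).
have p1 : p.[x1] != 0.
  rewrite horner_prod prodf_seq_neq0; apply/allP => y _; apply/implyP => yx.
  by rewrite !hornerE subr_eq0 eq_sym.
have px x : x \in s -> x != x1 -> p.[x] = 0.
  move=> xs xx1; apply/rootP; rewrite /p -big_filter root_prod_XsubC.
  by rewrite mem_filter xx1 mem_undup.
have E t : \sum_(i < size p) p`_i * (\sum_(x <- s) x ^+ (t + i))
    = (count_mem x1 s)%:R * p.[x1] * x1 ^+ t.
  transitivity (\sum_(x <- s) x ^+ t * p.[x]).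
    under eq_bigr do rewrite mulr_sumr; rewrite exchange_big /=.
    apply: eq_bigr => x _; rewrite horner_coef mulr_sumr.
    by apply: eq_bigr => i _; rewrite exprD mulrCA.
  rewrite (eq_big_seq (fun x => if x == x1 then p.[x1] * x1 ^+ t else 0)).
    by rewrite -big_mkcond big_const_seq iter_addr_0 -mulrA mulr_natl.
  move=> x xs; case: eqP => [->|/eqP xx1]; first by rewrite mulrC.
  by rewrite px // mulr0.
pose A := `|(count_mem x1 s)%:R * p.[x1]|.
have A0 : 0 < A.
  by rewrite normr_gt0 mulf_neq0 // pnatr_eq0 -lt0n -has_count has_pred1.
pose B := \sum_(i < size p) `|p`_i| * (c * rho ^+ i).
have key t : (t0 <= t)%N -> (`|x1| / rho) ^+ t <= B / A.
  move=> tt; rewrite ler_pdivlMr // expr_div_n mulrAC ler_pdivrMr ?exprn_gt0 //.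
  rewrite -normrX mulrC -normrM -E (le_trans (ler_norm_sum _ _ _)) // mulr_suml.
  apply: ler_sum => i _; rewrite normrM -mulrA ler_wpM2l //.
  apply: le_trans (bnd _ _) _; first by rewrite (leq_trans tt) ?leq_addr.
  by rewrite exprD -mulrA [rho ^+ t * _]mulrC.
have := exp_bounded_le1 _ key.
by rewrite ler_pdivrMr // mul1r; apply; rewrite divr_ge0 // ltW.
Qed.

(** * Monic and irreducible polynomials over a finite field *)

Definition monics (F : finFieldType) (n : nat) : seq {poly F} :=
  [seq 'X^n + rVpoly v | v : 'rV[F]_n].

Definition irreds (F : finFieldType) (n : nat) : seq {poly F} :=
  [seq P <- monics F n | irreducibleb P].

Section Monics.

Variable F : finFieldType.
Implicit Types (g P : {poly F}) (n : nat).

Lemma mem_monics n g : (g \in monics F n) = (g \is monic) && (size g == n.+1).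
Proof.
apply/imageP/andP => [[v _ ->]|[gm /eqP sg]].
  have szv : (size (rVpoly v) < size ('X^n : {poly F}))%N.
    by rewrite size_polyXn ltnS size_poly.
  rewrite size_polyDl // size_polyXn; split=> //.
  by rewrite monicE lead_coefDl // lead_coefXn.
exists (poly_rV (g - 'X^n)) => //; rewrite poly_rV_K ?[_ + (g - _)]addrC ?subrK //.
apply/leq_sizeP => j; rewrite leq_eqVlt coefB coefXn => /orP[/eqP <-|ltj].
  by move: gm; rewrite monicE lead_coefE sg /= => /eqP ->; rewrite eqxx subrr.
by rewrite gtn_eqF // subr0 nth_default // sg.
Qed.

Lemma monics_uniq n : uniq (monics F n).
Proof.
rewrite map_inj_uniq ?enum_uniq // => u v /addrI.
exact: (can_inj (@rVpolyK _ _)).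
Qed.

Lemma size_monics n : size (monics F n) = (#|F| ^ n)%N.
Proof. by rewrite size_map -cardE card_mx mul1n. Qed.

Lemma monics0 : monics F 0 = [:: 1].
Proof.
have := size_monics 0; have := mem_monics 0 1.
rewrite monic1 size_poly1 expn0; case: (monics F 0) => [|g [|]] //=.
by rewrite inE => /eqP ->.
Qed.

Lemma mem_irreds n P :
  reflect [/\ P \is monic, size P = n.+1 & irreducible_poly P] (P \in irreds F n).
Proof.
rewrite mem_filter mem_monics; apply: (iffP and3P) => [[/irreducibleP]|[]].
  by move=> ? ? /eqP.
by move=> ? /eqP ? /irreducibleP.
Qed.

Lemma monic_irred_coprime P Q :
  P \is monic -> Q \is monic -> irreducible_poly P -> irreducible_poly Q ->
  P != Q -> coprimep P Q.
Proof.
move=> Pm Qm Pi Qi; rewrite irreducible_poly_coprime //; apply: contraNN => PQ.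
have Ps : size P != 1%N by case: Pi => /ltn_eqF; rewrite eq_sym => ->.
by rewrite -eqp_monic // apply_irredp.
Qed.

Lemma exists_monic_irred_dvdp g :
  (1 < size g)%N ->
  exists P, [/\ P \is monic, irreducible_poly P & P %| g].
Proof.
move=> sg; have g0 : g != 0 by rewrite -size_poly_gt0 ltnW.
pose has_div n := (0 < n)%N && has (fun P => P %| g) (monics F n).
have norm (h : {poly F}) : h != 0 -> (1 < size h)%N -> h %| g -> has_div (size h).-1.
  move=> h0 sh hg; rewrite /has_div -subn1 subn_gt0 sh subn1.
  apply/hasP; exists ((lead_coef h)^-1 *: h).
    rewrite mem_monics monicE lead_coefZ mulVf ?lead_coef_eq0 // eqxx /=.
    by rewrite size_scale ?invr_eq0 ?lead_coef_eq0 // prednK // ltnW.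
  by rewrite dvdpZl // invr_eq0 lead_coef_eq0.
have ex_div : exists n, has_div n by exists (size g).-1; apply: norm.
case: (ex_minnP ex_div) => n /andP[n0 /hasP[P]]; rewrite mem_monics.
move=> /andP[Pm /eqP sP] Pg minn; exists P; split=> //; split=> [|h sh hP].
  by rewrite sP.
have P0 := monic_neq0 Pm; have h0 : h != 0 by apply: contraNneq P0 => h0; rewrite -dvd0p -h0.
have h1 : (1 < size h)%N by rewrite ltn_neqAle eq_sym sh size_poly_gt0.
rewrite -dvdp_size_eqp // eqn_leq dvdp_leq //= sP -(prednK (ltnW h1)) ltnS.
by apply: minn; apply: norm => //; apply: dvdp_trans Pg.
Qed.

Lemma sum_telescope_dvdn (f : nat -> nat) d N : (0 < d)%N ->
  (\sum_(1 <= k < N.+1 | d %| k) f (k %/ d).-1 + f (N %/ d)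
  = f 0 + \sum_(1 <= k < N.+1 | d %| k) f (k %/ d))%N.
Proof.
move=> d0; elim: N => [|N IHN]; first by rewrite !big_geq // div0n addn0.
rewrite big_mkcond big_nat_recr //= -big_mkcond.
rewrite [in RHS]big_mkcond big_nat_recr //= -[X in (f 0 + (X + _))%N]big_mkcond.
rewrite addnA -IHN divnS //.
by case: (d %| N.+1)%N => /=; rewrite ?add1n ?addn0 //= ?add0n.
Qed.

(** The multiplicity of [P] in [g] when [P] has degree [d] and [N] is at least the degree of [g].
    Indexing by [k], the degree of the prime power, matches the sums in [lfun_newton]. *)
Definition prime_mult N d P g : nat :=
  (\sum_(1 <= k < N.+1 | d %| k) (P ^+ (k %/ d)%N %| g)%R)%N.

Lemma prime_mult_prime_mul N d P d0 P0 g :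
  P \in irreds F d -> P0 \in irreds F d0 -> g \is monic -> (0 < d)%N ->
  (size (P0 * g)%R <= N.+1)%N ->
  prime_mult N d P (P0 * g) = (prime_mult N d P g + (P == P0))%N.
Proof.
move=> /mem_irreds[Pm sP Pi] /mem_irreds[P0m sP0 P0i] gm d_gt0.
case: (eqVneq P P0) => [<-|PP0] sg.
  have PN : (P ^+ (N %/ d) %| g) = false.
    apply/negP => /(dvdp_leq (monic_neq0 gm)).
    have PN0 : P ^+ (N %/ d) != 0 by rewrite monic_neq0 // monic_exp.
    move: sg; rewrite size_monicM ?monic_neq0 // sP.
    have := size_exp P (N %/ d); rewrite sP /=.
    have : (0 < size (P ^+ (N %/ d)%N)%R)%N by rewrite size_poly_gt0.
    have := ltn_ceil N d_gt0.
    have : (0 < size g)%N by rewrite size_poly_gt0 monic_neq0.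
    move: (N %/ d)%N => t; clear; rewrite mulSn mulnC.
    by move: (d * t)%N (size _) => dt; case: (size _) => [|x] *; lia.
  have := sum_telescope_dvdn (fun j => nat_of_bool (P ^+ j %| g)%R) N d_gt0.
  rewrite /= PN addn0 expr0 dvd1p /= addnC => <-; rewrite /prime_mult.
  rewrite big_seq_cond [RHS]big_seq_cond.
  apply: eq_bigr => k /andP[]; rewrite mem_index_iota => /andP[k1 _] dk.
  have kd : (0 < k %/ d)%N by rewrite divn_gt0 // dvdn_leq.
  rewrite -[in LHS](prednK kd) exprS dvdp_mul2l //.
  by rewrite monic_neq0.
rewrite addn0; apply: eq_bigr => k _; rewrite Gauss_dvdpr //.
apply: coprimep_expl; exact: monic_irred_coprime.
Qed.

Lemma sum_irreds_eq d d0 P0 :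
  P0 \in irreds F d0 -> (\sum_(P <- irreds F d) (P == P0) = (d == d0))%N.
Proof.
move=> P0in; transitivity (count_mem P0 (irreds F d)).
  by rewrite -sum1_count [RHS]big_mkcond; apply: eq_bigr => P _ /=; case: (P == P0).
rewrite count_uniq_mem ?filter_uniq ?monics_uniq //; congr nat_of_bool.
have /mem_irreds[_ sP0 _] := P0in.
apply/idP/eqP => [/mem_irreds[_ + _]|->//].
by rewrite sP0 => /eqP; rewrite eqSS eq_sym => /eqP.
Qed.

(** Unique factorization read in degrees; the induction strips one irreducible factor at a time. *)
Lemma sum_prime_mult N g :
  g \is monic -> (size g <= N.+1)%N ->
  (\sum_(1 <= d < N.+1) \sum_(P <- irreds F d) d * prime_mult N d P g
    = (size g).-1)%N.
Proof.
have [n] := ubnP (size g); elim: n g => // n IHn g sgn gm sgN.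
have irr_gt0 d P : P \in irreds F d -> (0 < d)%N.
  by move=> /mem_irreds[_ sP [+ _]]; rewrite sP.
case: (leqP (size g) 1) => [sg1|sg1].
  have g1 : g = 1.
    apply/eqP; rewrite -eqp_monic ?monic1 // -size_poly_eq1 eqn_leq sg1.
    by rewrite size_poly_gt0 monic_neq0.
  rewrite {1}g1 big_nat_cond big1 => [|d /andP[/andP[d1 _] _]].
    by rewrite g1 size_poly1.
  rewrite big_seq big1 // => P /mem_irreds[Pm sP Pi]; rewrite /prime_mult.
  rewrite big_nat_cond big1 ?muln0 // => k /andP[/andP[k1 _] dk].
  apply/eqP; rewrite eqb0 dvdp1; apply/eqP => s1.
  have := size_exp P (k %/ d); rewrite s1 sP /= => /esym/eqP.
  by rewrite muln_eq0 !eqn0Ngt d1 divn_gt0 // dvdn_leq.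
have [P0 [P0m P0i P0g]] := exists_monic_irred_dvdp sg1.
have [g' gE] : exists g' : {poly F}, g = P0 * g'.
  by case/dvdpP: P0g => g' ->; exists g'; rewrite mulrC.
pose d0 := (size P0).-1.
have g'm : g' \is monic by move: gm; rewrite gE monicMl.
have sP0 : size P0 = d0.+1 by rewrite prednK // size_poly_gt0 monic_neq0.
clearbody d0; have d0_gt0 : (0 < d0)%N by case: P0i; rewrite sP0.
have P0in : P0 \in irreds F d0 by apply/mem_irreds.
have sgE : size g = (d0 + size g')%N by rewrite gE size_monicM ?monic_neq0 // sP0.
have sg'_gt0 : (0 < size g')%N by rewrite size_poly_gt0 monic_neq0.
transitivity (\sum_(1 <= d < N.+1) \sum_(P <- irreds F d) d * prime_mult N d P g'
   + \sum_(1 <= d < N.+1) d * (d == d0))%N.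
  rewrite -big_split; apply: eq_bigr => d _ /=.
  rewrite -(sum_irreds_eq d P0in).
  rewrite big_distrr /= -big_split /= big_seq [RHS]big_seq.
  apply: eq_bigr => P Pin; rewrite -mulnDr gE (prime_mult_prime_mul _ P0in) //.
    exact: irr_gt0 Pin.
  by rewrite -gE.
rewrite IHn //; [|by lia|by lia].
rewrite (bigD1_seq d0) ?iota_uniq ?mem_index_iota //=; last by lia.
rewrite eqxx muln1 big1 ?addn0 => [|d /negPf ->]; last by rewrite muln0.
by rewrite sgE -[in RHS](prednK sg'_gt0) addnS addnC.
Qed.

Lemma sum_monics_dvdp (C : comNzRingType) (chi : {poly F} -> C) P d j n :
  (forall g h, chi (g * h) = chi g * chi h) ->
  P \is monic -> size P = d.+1 -> (j * d <= n)%N ->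
  \sum_(g <- monics F n | P ^+ j %| g) chi g
    = chi (P ^+ j) * \sum_(g <- monics F (n - j * d)) chi g.
Proof.
move=> chiM Pm sP jdn; rewrite -big_filter mulr_sumr.
have Pjm : P ^+ j \is monic by rewrite monic_exp.
have sPj : size (P ^+ j) = (j * d).+1.
  rewrite mulnC -[d]/(d.+1.-1) -sP -size_exp prednK //.
  by rewrite size_poly_gt0 monic_neq0.
rewrite -(eq_bigr _ (fun g _ => chiM (P ^+ j) g)).
rewrite -(big_map (fun g => P ^+ j * g) xpredT chi); apply: perm_big.
apply: uniq_perm; first by rewrite filter_uniq ?monics_uniq.
  by rewrite map_inj_uniq ?monics_uniq //; apply: mulfI; rewrite monic_neq0.
move=> g; rewrite mem_filter mem_monics; apply/and3P/mapP => [[]|[h]].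
  case/dvdpP=> h; rewrite mulrC => -> gm sg; exists h => //.
  move: gm sg; rewrite monicMl // => hm.
  by rewrite size_monicM ?monic_neq0 // mem_monics hm sPj /= => /eqP; lia.
rewrite mem_monics => /andP[hm /eqP sh] ->.
rewrite dvdp_mulr ?dvdpp // monicMl // hm; split=> //.
by rewrite size_monicM ?monic_neq0 // sPj sh /=; apply/eqP; lia.
Qed.

End Monics.

(* The L-function of chi is L(T) = sum_n (lfun_coef n) T^n, and its Euler
   product gives T L'/L = sum_k (lfun_sum k) T^k. *)
Definition lfun_coef (F : finFieldType) (C : comNzRingType)
    (chi : {poly F} -> C) n : C :=
  \sum_(g <- monics F n) chi g.

Definition lfun_sum (F : finFieldType) (C : comNzRingType)
    (chi : {poly F} -> C) k : C :=
  \sum_(1 <= d < k.+1 | (d %| k)%N) \sum_(P <- irreds F d)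
    d%:R * chi P ^+ (k %/ d).

(** The factor [n] is the degree of each [g], which [sum_prime_mult] spreads over the prime powers
    dividing [g]. Writing [g = P ^+ j * h] and grouping by the degree [k] of [P ^+ j] replaces the
    infinite Euler product. *)
Lemma lfun_newton (F : finFieldType) (C : comNzRingType)
    (chi : {poly F} -> C) n :
  chi 1 = 1 -> (forall g h, chi (g * h) = chi g * chi h) ->
  n%:R * lfun_coef chi n
  = \sum_(1 <= k < n.+1) lfun_sum chi k * lfun_coef chi (n - k).
Proof.
move=> chi1 chiM.
have chiX P j : chi (P ^+ j) = chi P ^+ j.
  by elim: j => [|j IHj]; rewrite ?expr0 // !exprS chiM IHj.
transitivity (\sum_(g <- monics F n) \sum_(1 <= d < n.+1)
    \sum_(P <- irreds F d) (d * prime_mult n d P g)%:R * chi g).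
  rewrite mulr_sumr big_seq [RHS]big_seq; apply: eq_bigr => g.
  rewrite mem_monics => /andP[gm /eqP sg].
  have := sum_prime_mult gm (N := n); rewrite sg leqnn => /(_ isT) /= Hn.
  rewrite -[X in X%:R * _]Hn natr_sum mulr_suml; apply: eq_bigr => d _.
  by rewrite natr_sum mulr_suml.
transitivity (\sum_(1 <= d < n.+1) \sum_(P <- irreds F d)
    \sum_(1 <= k < n.+1 | (d %| k)%N)
       d%:R * chi P ^+ (k %/ d) * lfun_coef chi (n - k)).
  rewrite exchange_big /=; apply: eq_bigr => d _.
  rewrite exchange_big /= big_seq [RHS]big_seq; apply: eq_bigr => P.
  move=> /mem_irreds[Pm sP _].
  transitivity (\sum_(1 <= k < n.+1 | (d %| k)%N) \sum_(g <- monics F n)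
      (d * (P ^+ (k %/ d) %| g)%R)%:R * chi g).
    rewrite exchange_big /=; refine (eq_bigr _ _) => g _.
    by rewrite /prime_mult big_distrr /= natr_sum mulr_suml.
  apply: congr_big_nat => // k /and3P[dk _ kn].
  transitivity (d%:R * \sum_(g <- monics F n | P ^+ (k %/ d) %| g) chi g).
    rewrite mulr_sumr [RHS]big_mkcond; apply: eq_bigr => g _ /=.
    by case: ifP => _; rewrite ?muln1 ?muln0 ?mul0r.
  rewrite (sum_monics_dvdp chiM Pm sP) divnK //.
  by rewrite chiX mulrA.
rewrite (eq_bigr (fun d => \sum_(1 <= k < n.+1) if (d %| k)%N then
   \sum_(P <- irreds F d) d%:R * chi P ^+ (k %/ d) * lfun_coef chi (n - k) else 0)).
  rewrite exchange_big /= big_nat_cond [RHS]big_nat_cond; apply: eq_bigr => k.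
  rewrite andbT => /andP[k1 kn].
  rewrite (big_cat_nat (n := k.+1)) //= [X in _ + X]big_nat_cond.
  rewrite [X in _ + X]big1 ?addr0 => [|d /andP[/andP[kd _] _]]; last first.
    by case: ifP => // /(dvdn_leq k1); rewrite leqNgt kd.
  rewrite /lfun_sum mulr_suml [RHS]big_mkcond; apply: eq_bigr => d _ /=.
  by case: ifP => // _; rewrite mulr_suml.
move=> d _; rewrite -big_mkcond exchange_big /=; apply: eq_bigr => k _.
by [].
Qed.

(** The logarithmic derivative of the product, truncated after degree [N]; [J] absorbs the tail. *)
Lemma newton_prod (C : comNzRingType) (s : seq C) (N : nat) :
  exists J : {poly C},
    'X * (\prod_(w <- s) (1 - w%:P * 'X))^`()
    = 'X^(N.+1) * J
      - (\sum_(1 <= k < N.+1) (\sum_(w <- s) w ^+ k)%:P * 'X^k)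
        * \prod_(w <- s) (1 - w%:P * 'X).
Proof.
elim: s => [|w s [J IH]].
  exists 0; rewrite big_nil derivC big1 ?mul0r ?mulr0 ?subrr // => k _.
  by rewrite big_nil mul0r.
set p := \prod_(w <- s) _ in IH; set P := \sum_(1 <= k < N.+1) _ in IH.
pose W : {poly C} := \sum_(1 <= k < N.+1) (w%:P * 'X) ^+ k.
have geo : (1 - w%:P * 'X) * W = w%:P * 'X - (w%:P * 'X) ^+ N.+1.
  rewrite /W mulr_sumr (telescope_sumr_eq (fun k => - (w%:P * 'X) ^+ k)) //.
    by rewrite expr1 opprK addrC.
  by move=> k _; rewrite mulrBl mul1r opprK -exprS addrC.
have PW : \sum_(1 <= k < N.+1) (\sum_(w <- w :: s) w ^+ k)%:P * 'X^k = P + W.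
  rewrite -big_split; apply: eq_bigr => k _ /=.
  by rewrite big_cons polyCD mulrDl addrC exprMn polyC_exp.
rewrite PW big_cons -/p derivM derivB derivM derivX !derivC.
exists ((1 - w%:P * 'X) * J - w%:P ^+ N.+1 * p).
transitivity (- (w%:P * 'X * p) + (1 - w%:P * 'X) * ('X * p^`())); first by ring.
rewrite IH (_ : (P + W) * _ = P * ((1 - w%:P * 'X) * p)
  + (1 - w%:P * 'X) * W * p); last by ring.
by rewrite geo exprMn; ring.
Qed.

(* In terms of L = sum_n (a n) T^n: if L is a polynomial and T L'/L = sum_k (S k)
   T^k, then -S is the sequence of power sums of the reciprocal roots of L. *)
Lemma newton_roots (C : closedFieldType) (a S : nat -> C) (m : nat) :
  a 0%N = 1 -> (forall n, (m <= n)%N -> a n = 0) ->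
  (forall n, n%:R * a n = \sum_(1 <= k < n.+1) S k * a (n - k)%N) ->
  exists s : seq C,
    [/\ (size s <= m.-1)%N,
        forall k, (0 < k)%N -> S k = - \sum_(w <- s) w ^+ k
      & \sum_(n < m) a n = 0 -> 1 \in s].
Proof.
move=> a0 am newt; pose L := \poly_(i < m) a i.
have La i : L`_i = a i by rewrite coef_poly; case: ltnP => // /am ->.
have [r rE] := closed_field_poly_normal L.
have L0 : L != 0.
  by apply/eqP => /polyP/(_ 0%N); rewrite La a0 coef0; apply/eqP; rewrite oner_eq0.
have r0 z : z \in r -> z != 0.
  move=> zr; apply/negP => /eqP z0; have := La 0%N.
  rewrite -horner_coef0 a0 rE hornerZ (_ : (\prod_(z <- r) _).[0] = 0).
    by rewrite mulr0 => /esym/eqP; rewrite oner_eq0.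
  by apply/rootP; rewrite root_prod_XsubC -z0.
pose s := [seq z^-1 | z <- r].
have LE : L = \prod_(w <- s) (1 - w%:P * 'X).
  have [c E] : exists c, L = c *: \prod_(w <- s) (1 - w%:P * 'X).
    exists (lead_coef L * \prod_(z <- r) - z).
    rewrite {1}rE -scalerA; congr (_ *: _).
    rewrite big_map big_seq [X in X *: _]big_seq -!mul_polyC.
    rewrite [X in _ * X]big_seq rmorph_prod -big_split /=.
    apply: eq_bigr => z zr; rewrite mulrBr mulr1 mulrA -polyCM mulNr mulfV ?r0 //.
    by rewrite !polyCN polyC1 mulN1r opprK addrC.
  have := congr1 (horner^~ 0) E; rewrite horner_coef0 La a0 hornerZ horner_prod.
  rewrite big1 => [|w _]; last first.
    by rewrite hornerD hornerN hornerCM hornerX mulr0 subr0 hornerE.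
  by rewrite mulr1 E => <-; rewrite scale1r.
exists s; split.
- have szL : size L = (size r).+1.
    by rewrite rE size_scale ?lead_coef_eq0 // size_prod_XsubC.
  have : (size L <= m)%N := size_poly _ _.
  by rewrite szL size_map => szr; rewrite -ltnS (leq_trans szr) // leqSpred.
(* By [newton_prod] the negated power sums obey the same recurrence as [S], and since [a 0 = 1] it
   determines each term from the earlier ones. *)
- move=> n; have [k] := ubnP n; elim: k n => // k IHk n nk n0.
  have [J] := newton_prod s n; rewrite -LE => /polyP/(_ n).
  rewrite coefXM coefB coefXnM ltnS leqnn sub0r -(prednK n0) eqn0Ngt /= coef_deriv.
  rewrite La -mulr_natl prednK // newt mulr_suml coef_sum big_nat_recr //=.
  rewrite [in RHS](eq_big_nat _ _ (F2 := fun i => (\sum_(w <- s) w ^+ i) * a (n - i)%N)).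
    rewrite [in RHS]big_nat_recr //= subnn a0 !mulr1 opprD.
    rewrite (eq_big_nat _ _ (F2 := fun i => - ((\sum_(w <- s) w ^+ i) * a (n - i)%N))).
      by rewrite sumrN => /addrI.
    by move=> i /andP[i0 ltin]; rewrite IHk ?mulNr // (leq_trans ltin).
  move=> i /andP[i0 ltin].
  by rewrite -mulrA coefCM coefXnM ltnNge -ltnS ltin /= La.
move=> sum0; apply/mapP; exists 1; rewrite ?invr1 //.
rewrite -root_prod_XsubC.
have : root L 1.
  rewrite /root horner_poly (eq_bigr (fun i : 'I_m => a i)) ?sum0 // => i _.
  by rewrite expr1n mulr1.
by rewrite {1}rE rootZ ?lead_coef_eq0.
Qed.

Lemma monic_eq_prime_power (F : finFieldType) (P g : {poly F}) :
  P \is monic -> irreducible_poly P -> g \is monic ->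
  (forall P', P' \is monic -> irreducible_poly P' -> P' %| g -> P' = P) ->
  exists j, g = P ^+ j.
Proof.
move=> Pm Pi; have [n] := ubnP (size g); elim: n g => // n IHn g sgn gm uP.
case: (leqP (size g) 1) => [sg1|sg1].
  exists 0%N; apply/eqP; rewrite expr0 -eqp_monic ?monic1 // -size_poly_eq1.
  by rewrite eqn_leq sg1 size_poly_gt0 monic_neq0.
have [P0 [P0m P0i P0g]] := exists_monic_irred_dvdp sg1.
have PP0 := uP _ P0m P0i P0g; rewrite {}PP0 in P0g.
have [h gE] : exists h : {poly F}, g = P * h.
  by case/dvdpP: P0g => h ->; exists h; rewrite mulrC.
have hm : h \is monic by move: gm; rewrite gE monicMl.
have [||P' P'm P'i P'h|j hE] := IHn h => //.
- move: sgn; rewrite gE size_monicM ?monic_neq0 //; case: Pi => + _.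
  case: (size P) => [|[|sP]] //= _; rewrite addSn /= ltnS.
  by apply: leq_ltn_trans; rewrite leq_addl.
- by apply: uP => //; rewrite gE dvdp_mull.
by exists j.+1; rewrite gE hE exprS.
Qed.

(** [lfun_newton] for the trivial character: the coefficients are [#|F| ^ m], and the recurrence
    forces the same values on [lfun_sum]. *)
Lemma sum_irreds_degree (F : finFieldType) n : (0 < n)%N ->
  (\sum_(1 <= d < n.+1 | d %| n) \sum_(P <- irreds F d) d = #|F| ^ n)%N.
Proof.
pose chi := fun _ : {poly F} => 1%Z.
have coefE m : lfun_coef chi m = (#|F| ^ m)%N%:Z.
  rewrite /lfun_coef big_const_seq iter_addr_0 count_predT size_monics.
  by rewrite natz.
suff sumE m : (0 < m)%N -> lfun_sum chi m = (#|F| ^ m)%N%:Z.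
  move=> n0; apply/eqP; rewrite -eqz_nat -sumE // /lfun_sum.
  rewrite -natz natr_sum; apply/eqP; apply: eq_bigr => d _.
  by rewrite natr_sum; apply: eq_bigr => P _; rewrite expr1n mulr1.
have [b] := ubnP m; elim: b m => // b IHb m mb m0.
have := lfun_newton (chi := chi) m erefl (fun g h => erefl (1%Z)).
rewrite big_nat_recr //= subnn !coefE expn0 mulr1.
rewrite (eq_big_nat _ _ (F2 := fun=> (#|F| ^ m)%N%:Z)).
  rewrite big_const_nat iter_addr_0 subn1 -[_ *+ m.-1]mulr_natl.
  by rewrite -{1}(prednK m0) -natr1 mulrDl mul1r => /addrI.
move=> i /andP[i0 im]; rewrite IHb ?coefE ?(leq_trans im) //.
by rewrite -PoszM -expnD subnKC // ltnW.
Qed.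

(** * Finite extensions *)

Lemma card_pnat_pchar (L : finFieldType) : [pchar L].-nat #|L|.
Proof.
have [p _ pL] := finPcharP L.
have := pprimeChar_pgroup pL; rewrite /pgroup.pgroup cardsT.
by rewrite (eq_pnat _ (pcharf_eq pL)).
Qed.

(** Otherwise the smaller degrees would account for all of [#|F| ^ n] in [sum_irreds_degree], but
    they contribute at most a geometric sum below it. *)
Lemma irreds_neq_nil (F : finFieldType) n : (0 < n)%N ->
  exists P, P \in irreds F n.
Proof.
move=> n0; have q_gt1 := card_finNzRing_gt1 F.
have degsum d : (0 < d)%N -> (\sum_(P <- irreds F d) d <= #|F| ^ d)%N.
  move=> d0; rewrite -(sum_irreds_degree F d0) [X in (_ <= X)%N]big_mkcond.
  rewrite big_nat_recr //= dvdnn.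
  exact: leq_addl.
case irrE: (irreds F n) => [|P s]; last by exists P; rewrite mem_head.
have := sum_irreds_degree F n0; rewrite big_mkcond big_nat_recr //= dvdnn irrE.
rewrite big_nil addn0 => sumE.
have : (\sum_(1 <= d < n) #|F| ^ d < #|F| ^ n)%N.
  elim: (n) {n0 sumE irrE} => [|m IHm]; first by rewrite big_geq.
  case: m IHm => [|m] IHm; first by rewrite big_geq // expn_gt0 ltnW.
  rewrite big_nat_recr //= [X in (_ < X)%N]expnS; apply: (@leq_trans (2 * #|F| ^ m.+1)).
    by rewrite mul2n -addnn ltn_add2r.
  by rewrite leq_mul2r q_gt1 orbT.
rewrite ltnNge -sumE; case/negP; rewrite big_nat_cond [X in (_ <= X)%N]big_nat_cond.
apply: leq_sum => d /andP[/andP[d0 _] _]; case: ifP => // _.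
exact: degsum.
Qed.

Lemma exists_finite_extension (F : finFieldType) n : (0 < n)%N ->
  exists (K : finFieldType) (iota : {rmorphism F -> K}), #|K| = (#|F| ^ n)%N.
Proof.
move=> /(irreds_neq_nil F)[P /mem_irreds[_ sP Pi]].
have [L dimL _] := irredp_FAdjoin Pi.
exists (finvect_type L : finFieldType), (GRing.in_alg (finvect_type L)).
have := @card_vspacef F (finvect_type L) (Vector.class (finvect_type L)).
by rewrite card_vspace dimL sP => <-.
Qed.

Section FiniteExtension.

Variables (F K : finFieldType) (iota : {rmorphism F -> K}) (k : nat).
Hypotheses (k_gt0 : (0 < k)%N) (cardK : #|K| = (#|F| ^ k)%N).
Local Notation q := #|F|.
Local Notation "p ^i" := (map_poly iota p) (at level 2, format "p ^i").

Lemma fixed_frobenius_in_base (y : K) : y ^+ q = y -> exists a, y = iota a.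
Proof.
move=> yq; have : root ('X^q - 'X : {poly F})^i y.
  by rewrite /root rmorphB /= map_polyXn map_polyX !hornerE yq subrr.
rewrite finField_genPoly rmorph_prod /= /root horner_prod prodf_seq_eq0.
case/hasP => a _ /=; rewrite map_polyXsubC !hornerE subr_eq0 => /eqP ->.
by exists a.
Qed.

Lemma pnat_pchar_base i : [pchar K].-nat (q ^ i)%N.
Proof.
have := card_pnat_pchar K; rewrite cardK !pnatX => /orP[->//|/eqP k0].
by have := k_gt0; rewrite k0.
Qed.

Lemma poly_frobenius_descent (G : {poly K}) :
  G ^+ q = G \Po 'X^q -> exists g, G = g^i.
Proof.
have q_gt0 : (0 < q)%N by rewrite ltnW // card_finNzRing_gt1.
have pq : [pchar {poly K}].-nat q.
  by rewrite (eq_pnat _ (pchar_poly K)) -[q]expn1 pnat_pchar_base.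
move=> GG; have Gi i : exists a, G`_i == iota a.
  have [|a ->] := fixed_frobenius_in_base (y := G`_i); last by exists a.
  transitivity ((G ^+ q)`_(i * q)).
    rewrite -[G in RHS]coefK poly_def expr_sum_pchar //.
    rewrite (eq_bigr (fun j : 'I__ => (G`_j ^+ q) *: 'X^(j * q))); last first.
      by move=> j _; rewrite exprZn exprM.
    rewrite coef_sumMXn; case: (ltnP i (size G)) => [ltiG|leGi].
      rewrite (big_pred1 (Ordinal ltiG)) // => j.
      by rewrite eqn_pmul2r // -val_eqE.
    rewrite nth_default // expr0n eqn0Ngt q_gt0 big_pred0 // => j.
    by rewrite eqn_pmul2r // ltn_eqF // (leq_trans (ltn_ord j)).
  by rewrite GG !coefE // dvdn_mull // mulnK.
exists (\poly_(i < size G) xchoose (Gi i)); apply/polyP => i.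
rewrite coef_map coef_poly; case: ltnP => [_|leG].
  exact/eqP/(xchooseP (Gi i)).
by rewrite nth_default //; exact/esym/rmorph0.
Qed.

Lemma rmorph_card (a : F) i : iota a ^+ (q ^ i) = iota a.
Proof.
elim: i => [|i IHi]; first by rewrite expn0 expr1.
by rewrite expnS exprM -rmorphXn expf_card.
Qed.

Lemma root_rmorph_frobenius (P : {poly F}) (x : K) i :
  root P^i x -> root P^i (x ^+ (q ^ i)).
Proof.
have pqi := pnat_pchar_base i.
have PX : P^i.[x ^+ (q ^ i)] = P^i.[x] ^+ (q ^ i).
  rewrite !horner_coef expr_sum_pchar //; apply: eq_bigr => j _.
  by rewrite exprMn coef_map rmorph_card -!exprM mulnC.
by rewrite /root PX expf_eq0 => ->; rewrite expn_gt0 (ltnW (card_finNzRing_gt1 F)).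
Qed.

(* P is the minimal polynomial of x over F, and the second part expresses the
   norm of [iota w - x] as a power of P.[w]. *)
Lemma frobenius_minpoly (x : K) :
  exists d, exists2 P, [/\ P \in irreds F d, (d %| k)%N & root P^i x] &
    forall w, iota P.[w] ^+ (k %/ d) = (iota w - x) ^+ (\sum_(i < k) q ^ i)%N.
Proof.
(* The characteristic polynomial of [x] over [F]; conjugates repeat when [d < k], and it descends to
   [P ^+ (k %/ d)]. *)
pose G := \prod_(i < k) ('X - (x ^+ (q ^ i))%:P).
have q_gt0 : (0 < q)%N by rewrite ltnW // card_finNzRing_gt1.
have pq : [pchar {poly K}].-nat q.
  by rewrite (eq_pnat _ (pchar_poly K)) -[q]expn1 pnat_pchar_base.
have xk : x ^+ (q ^ k) = x by rewrite -cardK expf_card.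
have [g gE] : exists g, G = g^i.
  apply: poly_frobenius_descent.
  transitivity (\prod_(i < k) ('X^q - (x ^+ (q ^ i.+1))%:P)).
    rewrite -prodrXl; apply: eq_bigr => i _.
    by rewrite exprBn_pchar // -polyC_exp expnSr exprM.
  rewrite rmorph_prod /=.
  rewrite [RHS](eq_bigr (fun i : 'I_k => 'X^q - (x ^+ (q ^ i))%:P)); last first.
    by move=> i _; rewrite comp_polyB comp_polyX comp_polyC.
  case: (k) xk => [|k'] xk'; first by rewrite !big_ord0.
  by rewrite big_ord_recr big_ord_recl /= xk' expn0 expr1 mulrC.
have Gs : G = \prod_(y <- [seq x ^+ (q ^ i) | i : 'I_k]) ('X - y%:P).
  by rewrite big_map /G big_enum.
have gm : g \is monic.
  by rewrite -(map_monic iota) -gE Gs monic_prod_XsubC.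
have sg : size g = k.+1.
  by rewrite -(size_map_poly iota) -gE Gs size_prod_XsubC size_map size_enum_ord.
have [P [Pm Pi Pg]] : exists P, [/\ P \is monic, irreducible_poly P & P %| g].
  by apply: exists_monic_irred_dvdp; rewrite sg ltnS.
(* An irreducible factor has some [x ^+ (q ^ i)] as a root, and [k - i] further Frobenius steps
   carry it to [x]; so all irreducible factors share the root [x] and coincide. *)
have rootG P' : irreducible_poly P' -> P' %| g -> root P'^i x.
  move=> P'i; rewrite -(dvdp_map iota) -gE Gs => /dvdp_prod_XsubC[m P'E].
  have sP' : (1 < size P')%N by case: P'i.
  have := eqp_size P'E; rewrite size_map_poly size_prod_XsubC.
  case mE: (mask _ _) => [|y s] /= szP'; first by rewrite szP' in sP'.
  have : y \in [seq x ^+ (q ^ i) | i : 'I_k].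
    by apply: (@mem_mask _ y m); rewrite mE mem_head.
  case/mapP => i _ yE; have ik := ltn_ord i.
  have -> : x = y ^+ (q ^ (k - i)) by rewrite yE -exprM -expnD subnKC // ltnW.
  apply: root_rmorph_frobenius.
  by rewrite (eqp_root P'E) root_prod_XsubC mE mem_head.
have Px := rootG P Pi Pg.
have [j gP] : exists j, g = P ^+ j.
  apply: monic_eq_prime_power => // P' P'm P'i P'g; apply/eqP; apply/negPn/negP.
  move=> /(monic_irred_coprime P'm Pm P'i Pi); rewrite -(coprimep_map iota).
  by move=> /coprimep_root/(_ (rootG P' P'i P'g)); rewrite -/(root _ x) Px.
have sP : (0 < size P)%N by rewrite size_poly_gt0 monic_neq0.
have kE : k = ((size P).-1 * j)%N by rewrite -size_exp -gP sg.
have sP1_gt0 : (0 < (size P).-1)%N by have := k_gt0; rewrite kE muln_gt0 => /andP[].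
exists (size P).-1, P.
  by split=> //; [apply/mem_irreds; rewrite prednK | rewrite kE dvdn_mulr].
move=> w; rewrite [X in _ ^+ (X %/ _)]kE mulKn // -rmorphXn -horner_exp -gP.
rewrite -horner_map -gE /G horner_prod -prodrXr.
apply: eq_bigr => i _; rewrite !hornerE exprBn_pchar ?rmorph_card //.
exact: pnat_pchar_base.
Qed.

Lemma irreds_root_uniq d d' P P' x :
  P \in irreds F d -> P' \in irreds F d' -> root P^i x -> root P'^i x -> P = P'.
Proof.
move=> /mem_irreds[Pm _ Pi] /mem_irreds[P'm _ P'i] Px P'x.
apply/eqP/negPn/negP => /(monic_irred_coprime Pm P'm Pi P'i).
rewrite -(coprimep_map iota) => /coprimep_root/(_ Px).
by rewrite -/(root _ x) P'x.
Qed.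

Lemma sum_irreds_root (V : nmodType) (Y : nat -> {poly F} -> V) d0 P0 x :
  P0 \in irreds F d0 -> (d0 %| k)%N -> root P0^i x ->
  \sum_(1 <= d < k.+1 | (d %| k)%N) \sum_(P <- irreds F d | root P^i x) Y d P
    = Y d0 P0.
Proof.
move=> P0in d0k P0x; have /mem_irreds[_ sP0 [P0s _]] := P0in.
have d0in : d0 \in index_iota 1 k.+1.
  rewrite mem_index_iota; apply/andP; split; last by rewrite ltnS dvdn_leq.
  by move: P0s; rewrite sP0.
rewrite big_mkcond (bigD1_seq d0) ?iota_uniq //= d0k.
rewrite [X in _ + X]big1 ?addr0 => [|d dd0].
  rewrite big_mkcond (bigD1_seq P0) ?filter_uniq ?monics_uniq //= P0x.
  rewrite [X in _ + X]big_seq_cond [X in _ + X]big1 ?addr0 // => P /andP[Pin PP0].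
  by case: ifP => // Px; rewrite (irreds_root_uniq Pin P0in Px P0x) eqxx in PP0.
case: ifP => // _; rewrite big_seq_cond big1 // => P /andP[Pin Px].
have /mem_irreds[_ sP _] := Pin; have := irreds_root_uniq Pin P0in Px P0x.
move=> PP0; move: sP; rewrite PP0 sP0 => -[d0d].
by rewrite d0d eqxx in dd0.
Qed.

Lemma card_roots_irreds_le d P :
  P \in irreds F d -> (#|[set x | root P^i x]| <= d)%N.
Proof.
move=> /mem_irreds[Pm sP _]; have P0 : P^i != 0 by rewrite map_poly_eq0 monic_neq0.
have := max_poly_roots P0 (rs := enum [set x | root P^i x]).
rewrite size_map_poly sP ltnS -cardE enum_uniq; apply=> //.
by apply/allP => x; rewrite mem_enum inE.
Qed.

(** Each count is at most the degree, while both totals equal [#|K|], so equality holds term by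
    term. *)
Lemma card_roots_irreds d P :
  (0 < d)%N -> (d %| k)%N -> P \in irreds F d -> #|[set x | root P^i x]| = d.
Proof.
move=> d0 dk Pin.
have sumE : (\sum_(1 <= d < k.+1 | d %| k) \sum_(P <- irreds F d)
     #|[set x | root P^i x]| = \sum_(1 <= d < k.+1 | d %| k) \sum_(P <- irreds F d) d)%N.
  rewrite sum_irreds_degree // -cardK -sum1_card.
  transitivity (\sum_(x : K) \sum_(1 <= d < k.+1 | d %| k)
     \sum_(P <- irreds F d | root P^i x) 1)%N; last first.
    apply: eq_bigr => x _; have [d1 [P1 [P1in d1k P1x] _]] := frobenius_minpoly x.
    exact: (sum_irreds_root (fun _ _ => 1%N) P1in d1k P1x).
  rewrite [RHS]exchange_big; apply: eq_bigr => d' _.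
  rewrite (exchange_big_dep xpredT) //=; apply: eq_bigr => P' _.
  by rewrite -sum1_card; apply: eq_bigl => x; rewrite inE.
have := congr1 (fun n => (\sum_(1 <= d < k.+1 | d %| k) \sum_(P <- irreds F d) d - n)%N) sumE.
rewrite /= subnn -sumnB => [|d' _]; last first.
  by rewrite big_seq [X in (_ <= X)%N]big_seq; apply: leq_sum => P' /card_roots_irreds_le.
move/eqP; rewrite sum_nat_seq_eq0 => /allP/(_ d).
rewrite mem_index_iota d0 ltnS dvdn_leq // => /(_ isT) /=; rewrite dk /=.
rewrite subn_eq0 => led; apply/eqP; rewrite eqn_leq card_roots_irreds_le //=.
move: led; rewrite (big_rem P) // [X in (_ <= X)%N](big_rem P) //=.
set S1 := (\sum_(_ <- _) d)%N; set S2 := (\sum_(_ <- _) #|_|)%N.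
have : (S2 <= S1)%N.
  rewrite /S1 /S2 big_seq [X in (_ <= X)%N]big_seq; apply: leq_sum => P'.
  by move=> /mem_rem/card_roots_irreds_le.
by clear; move: (#|_|) => *; lia.
Qed.

(** Group the [x] in [K] by minimal polynomial: the factor [d] in [lfun_sum] counts the roots of
    [P]. *)
Lemma lfun_sum_extension (C : comNzRingType) (chi : {poly F} -> C) (X : K -> C) :
  (forall d P x, P \in irreds F d -> (d %| k)%N -> root P^i x ->
     X x = chi P ^+ (k %/ d)) ->
  lfun_sum chi k = \sum_x X x.
Proof.
move=> Xchi.
transitivity (\sum_(x : K) \sum_(1 <= d < k.+1 | (d %| k)%N)
     \sum_(P <- irreds F d | root P^i x) chi P ^+ (k %/ d)); last first.
  apply: eq_bigr => x _; have [d1 [P1 [P1in d1k P1x] _]] := frobenius_minpoly x.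
  rewrite (sum_irreds_root (fun d P => chi P ^+ (k %/ d)) P1in d1k P1x).
  exact/esym/Xchi.
rewrite exchange_big; rewrite /lfun_sum; apply: congr_big_nat => // d.
case/and3P => dk d0 _; rewrite (exchange_big_dep xpredT) //= big_seq [RHS]big_seq.
apply: eq_bigr => P Pin; rewrite mulr_natl.
rewrite -[X in _ *+ X](card_roots_irreds d0 dk Pin) -sumr_const; apply: eq_bigl => x.
by rewrite inE.
Qed.

End FiniteExtension.

(** * The Weil bound *)

Lemma prim_root_neq0 (R : nzRingType) n (x : R) : n.-primitive_root x -> x != 0.
Proof.
move=> xn; apply/eqP => x0; have := prim_expr_order xn.
rewrite x0 expr0n gtn_eqF ?(prim_order_gt0 xn) //= => /eqP.
by rewrite eq_sym oner_eq0.
Qed.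

(* Composed with x |-> x^((|L| - 1) / r) this is a multiplicative character of
   order r of a finite field L, extended by 0 at 0. *)
Definition unity_char (L : fieldType) (r : nat) (z : L) (w : algC) (x : L) : algC :=
  if [pick i : 'I_r | x == z ^+ i] is Some i then w ^+ i else 0.

Section UnityChar.

Variables (r : nat) (w : algC).
Hypothesis w_prim : r.-primitive_root w.

Section OneField.

Variables (L : fieldType) (z : L).
Hypothesis z_prim : r.-primitive_root z.
Local Notation rho := (unity_char r z w).

Let r_gt0 : (0 < r)%N := prim_order_gt0 z_prim.

Lemma unity_charX i : rho (z ^+ i) = w ^+ i.
Proof.
rewrite /unity_char; case: pickP => [j /eqP zij | /(_ (Ordinal (ltn_pmod i r_gt0)))].
  apply/eqP; rewrite (eq_prim_root_expr w_prim) eq_sym.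
  by rewrite -(eq_prim_root_expr z_prim) zij.
by rewrite /= prim_expr_mod // eqxx.
Qed.

Lemma unity_char1 : rho 1 = 1.
Proof. by rewrite -(expr0 z) unity_charX expr0. Qed.

Lemma unity_char0 : rho 0 = 0.
Proof.
rewrite /unity_char; case: pickP => // j; rewrite eq_sym expf_eq0.
by rewrite (negPf (prim_root_neq0 z_prim)) andbF.
Qed.

(** The domain on which [unity_char] is multiplicative; elsewhere it takes the default value 0. *)
Definition unity0 (x : L) := (x == 0) || (x ^+ r == 1).

Lemma unity0P x : unity0 x -> x = 0 \/ exists i, x = z ^+ i.
Proof.
case/orP=> /eqP; first by left.
by move=> /(prim_rootP z_prim)[i ->]; right; exists i.
Qed.

Lemma unity0_exp x n : unity0 x -> unity0 (x ^+ n).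
Proof.
case: n => [|n]; first by rewrite expr0 /unity0 expr1n eqxx orbT.
case/orP => /eqP x1; first by rewrite x1 expr0n /unity0 eqxx.
by rewrite /unity0 -exprM mulnC exprM x1 expr1n eqxx orbT.
Qed.

Lemma unity0_mul x y : unity0 x -> unity0 y -> unity0 (x * y).
Proof.
rewrite /unity0 mulf_eq0 exprMn.
by case/orP=> /eqP ->; case/orP=> /eqP ->; rewrite ?eqxx ?mulr1 ?eqxx ?orbT.
Qed.

Lemma unity_charM x y : unity0 x -> unity0 y -> rho (x * y) = rho x * rho y.
Proof.
move=> /unity0P[->|[i ->]]; first by rewrite mul0r unity_char0 mul0r.
move=> /unity0P[->|[j ->]]; first by rewrite mulr0 unity_char0 mulr0.
by rewrite -exprD !unity_charX exprD.
Qed.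

Lemma unity_char_exp x n : unity0 x -> rho (x ^+ n) = rho x ^+ n.
Proof.
move=> ux; elim: n => [|n IHn]; first by rewrite !expr0 unity_char1.
by rewrite !exprS unity_charM ?unity0_exp // IHn.
Qed.

Lemma unity_char_prod (I : finType) (E : I -> L) :
  (forall i, unity0 (E i)) -> rho (\prod_i E i) = \prod_i rho (E i).
Proof.
move=> uE; suff [] : unity0 (\prod_i E i) /\ rho (\prod_i E i) = \prod_i rho (E i) by [].
elim/big_rec2: _ => [|i y1 y2 _ [uy <-]].
  by rewrite unity_char1 /unity0 expr1n eqxx orbT.
by rewrite unity0_mul ?unity_charM.
Qed.

End OneField.

Lemma unity_char_rmorph (L L' : fieldType) (iota : {rmorphism L -> L'}) (z x : L) :
  unity_char r (iota z) w (iota x) = unity_char r z w x.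
Proof.
rewrite /unity_char; congr (if _ is Some i then _ else _); apply: eq_pick => i.
by rewrite -rmorphXn (inj_eq (fmorph_inj iota)).
Qed.

End UnityChar.

Section Characters.

Variables (F : finFieldType) (r s : nat) (z0 : F) (w : algC) (e : 'I_r -> nat).
Hypothesis z0_prim : (#|F|.-1).-primitive_root z0.
Hypothesis cardF : #|F| = (r * s).+1.
Hypothesis w_prim : r.-primitive_root w.
Local Notation q := #|F|.
Local Notation z := (z0 ^+ s).
Local Notation rho := (unity_char r z w).

Lemma cofactor_gt0 : (0 < s)%N.
Proof.
have := card_finNzRing_gt1 F; rewrite cardF ltnS muln_gt0 => /andP[] //.
Qed.

Lemma node_prim : r.-primitive_root z.
Proof.
have := exp_prim_root z0_prim s.
rewrite cardF /= gcdnMl mulnK //; exact: cofactor_gt0.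
Qed.

(** A Dirichlet character modulo the product of the ['X - z ^+ i]. At the minimal polynomial of [x]
    it sees the norms of [z ^+ i - x], hence its link to sums over [x]. *)
Definition kummer_char (g : {poly F}) : algC :=
  \prod_(i < r) rho (g.[z ^+ i] ^+ s) ^+ e i.

Lemma unity0_exps (y : F) : unity0 r (y ^+ s).
Proof.
rewrite /unity0 expf_eq0 cofactor_gt0 /=; case: eqVneq => //= y0.
have q_gt0 := ltnW (card_finNzRing_gt1 F).
rewrite -exprM mulnC -[(r * s)%N]/((r * s).+1.-1) -cardF; apply/eqP.
by apply: (mulIf y0); rewrite -exprSr prednK // expf_card mul1r.
Qed.

Lemma kummer_char1 : kummer_char 1 = 1.
Proof.
rewrite /kummer_char big1 // => i _.
by rewrite hornerC expr1n (unity_char1 w_prim node_prim) expr1n.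
Qed.

Lemma kummer_charM g h : kummer_char (g * h) = kummer_char g * kummer_char h.
Proof.
rewrite -big_split; apply: eq_bigr => i _ /=.
by rewrite hornerM exprMn (unity_charM w_prim node_prim) ?unity0_exps // exprMn.
Qed.

Section Extension.

Variables (K : finFieldType) (iota : {rmorphism F -> K}) (k : nat).
Hypotheses (k_gt0 : (0 < k)%N) (cardK : #|K| = (q ^ k)%N).

(** [P.[z ^+ i] ^+ (k %/ d)] is the norm of [z ^+ i - x]; the norm exponent times [s] is
    [(#|K| - 1) / r]. *)
Lemma kummer_sum_extension :
  lfun_sum kummer_char k
  = \sum_x \prod_(i < r) unity_char r (iota z) w
               ((iota z ^+ i - x) ^+ (s * \sum_(j < k) q ^ j)%N) ^+ e i.
Proof.
apply: (lfun_sum_extension (iota := iota)) => // d P x Pin dk Px.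
have [d1 [P1 [P1in d1k P1x] P1E]] := frobenius_minpoly iota k_gt0 cardK x.
have PP1 := irreds_root_uniq Pin P1in Px P1x.
have d1E : d1 = d.
  have /mem_irreds[_ sP _] := Pin; have /mem_irreds[_ sP1 _] := P1in.
  by move: sP1; rewrite -PP1 sP => -[].
rewrite -{}PP1 {}d1E in P1E.
rewrite /kummer_char -prodrXl; apply: eq_bigr => i _.
rewrite -!exprM [(e i * _)%N]mulnC [in RHS]exprM; congr (_ ^+ _).
rewrite -(unity_char_exp w_prim node_prim) ?unity0_exps //.
rewrite -(unity_char_rmorph r w iota) -exprM mulnC exprM [in RHS]rmorphXn /=.
rewrite [(s * (k %/ d))%N]mulnC ![in RHS]exprM.
by rewrite P1E !rmorphXn.
Qed.

End Extension.
End Characters.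

(** * Degree and trivial zero of the L-function *)

Section KummerVanishing.

Variables (F : finFieldType) (r s : nat) (z0 : F) (w : algC) (e : 'I_r -> nat).
Hypothesis z0_prim : (#|F|.-1).-primitive_root z0.
Hypothesis cardF : #|F| = (r * s).+1.
Hypothesis w_prim : r.-primitive_root w.
Hypothesis e_lt : forall i, (e i < r)%N.
Local Notation q := #|F|.
Local Notation z := (z0 ^+ s).
Local Notation rho := (unity_char r z w).
Local Notation chi := (kummer_char s z0 w e).

Definition kummer_supp : {set 'I_r} := [set i | e i != 0%N].
Local Notation m := #|kummer_supp|.

Lemma kummer_node_inj : injective (fun i : 'I_r => z ^+ i).
Proof.
move=> i j /eqP; rewrite (eq_prim_root_expr (node_prim z0_prim cardF)).
by rewrite !modn_small ?ltn_ord // => /eqP/val_inj.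
Qed.

Lemma lagrange_node (i0 : 'I_r) : i0 \in kummer_supp ->
  exists l : {poly F}, [/\ (size l <= m)%N, l.[z ^+ i0] = 1
    & forall i, i \in kummer_supp -> i != i0 -> l.[z ^+ i] = 0].
Proof.
move=> i0s; pose p := \prod_(i in kummer_supp :\ i0) ('X - (z ^+ i)%:P).
have p0 : p.[z ^+ i0] != 0.
  rewrite horner_prod; apply/prodf_neq0 => i; rewrite !inE => /andP[ii0 _].
  rewrite !hornerE subr_eq0; apply: contra ii0 => /eqP/kummer_node_inj ->.
  exact: eqxx.
exists (p.[z ^+ i0]^-1 *: p); split.
- rewrite (leq_trans (size_scale_leq _ _)) // /p -big_enum size_prod_XsubC -cardE.
  by rewrite [X in (_ <= X)%N](cardsD1 i0) i0s.
- by rewrite hornerZ mulVf.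
move=> i ie ii0; suff pi0 : p.[z ^+ i] = 0 by rewrite hornerZ pi0 mulr0.
rewrite horner_prod (bigD1 i) /=; last by rewrite in_setD1 ii0 ie.
by rewrite hornerXsubC subrr mul0r.
Qed.

(* Adding multiples of the Lagrange polynomial l to g moves the value of g at the
   node i0 only; scaling that value by z0 multiplies chi by w ^+ e i0 != 1. *)
Lemma kummer_twist_sum (A : seq {poly F}) (i0 : 'I_r) (l : {poly F}) :
  uniq A -> i0 \in kummer_supp -> l.[z ^+ i0] = 1 ->
  (forall i, i \in kummer_supp -> i != i0 -> l.[z ^+ i] = 0) ->
  (forall g c, g \in A -> g + c *: l \in A) ->
  \sum_(g <- A) chi g = 0.
Proof.
move=> uA i0s l1 l0 Al.
pose phi v g := g + ((v - 1) * g.[z ^+ i0]) *: l.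
have z0n0 := prim_root_neq0 z0_prim.
have phiK u v : u * v = 1 -> cancel (phi v) (phi u).
  move=> uv g; rewrite /phi hornerD hornerZ l1 mulr1 -addrA -scalerDl.
  rewrite [X in _ + X *: _](_ : _ = (u * v - 1) * g.[z ^+ i0]); last by ring.
  by rewrite uv subrr mul0r scale0r addr0.
have rho_twist y : rho ((z0 * y) ^+ s) = w * rho (y ^+ s).
  rewrite exprMn (unity_charM w_prim (node_prim z0_prim cardF)) ?(unity0_exps cardF) //.
  by have := unity_charX w_prim (node_prim z0_prim cardF) 1; rewrite !expr1 => ->.
have chi_phi g : chi (phi z0 g) = w ^+ e i0 * chi g.
  rewrite /kummer_char (bigD1 i0) //= [in RHS](bigD1 i0) //= mulrA.
  congr (_ * _).
    rewrite /phi hornerD hornerZ l1 mulr1.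
    have -> : g.[z ^+ i0] + (z0 - 1) * g.[z ^+ i0] = z0 * g.[z ^+ i0] by ring.
    by rewrite rho_twist exprMn.
  apply: eq_bigr => i ii0; case: (boolP (i \in kummer_supp)) => [ie|].
    by rewrite /phi hornerD hornerZ (l0 _ ie ii0) mulr0 addr0.
  by rewrite inE negbK => /eqP ->; rewrite !expr0.
have perm : perm_eq [seq phi z0 g | g <- A] A.
  apply: uniq_perm => //.
    by rewrite map_inj_uniq //; apply: can_inj (phiK z0^-1 z0 _); rewrite mulVf.
  move=> g; apply/mapP/idP => [[h hA ->]|gA]; first exact: Al.
  exists (phi z0^-1 g); first exact: Al.
  by rewrite (phiK z0 z0^-1) // mulfV.
have : \sum_(g <- A) chi g = w ^+ e i0 * \sum_(g <- A) chi g.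
  rewrite -{1}(perm_big _ perm) big_map mulr_sumr.
  by apply: eq_bigr => g _; rewrite chi_phi.
move/eqP; rewrite -{1}[\sum_(g <- A) _]mul1r -subr_eq0 -mulrBl mulf_eq0.
case/orP => [|/eqP //]; rewrite subr_eq0 eq_sym => we.
have : (r %| e i0)%N by rewrite (prim_order_dvd w_prim).
by rewrite inE in i0s; rewrite gtnNdvd ?lt0n.
Qed.

(** The Lagrange polynomial has degree below [m], so adding its multiples keeps polynomials of
    degree [n >= m] monic. *)
Lemma kummer_coef_eq0 n : (0 < m)%N -> (m <= n)%N -> lfun_coef chi n = 0.
Proof.
move=> /card_gt0P[i0 i0s] mn; have [l [sl l1 l0]] := lagrange_node i0s.
apply: (kummer_twist_sum (monics_uniq F n) i0s l1 l0) => g c.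
rewrite !mem_monics => /andP[gm /eqP sg].
have lt : (size (c *: l) < size g)%N.
  by rewrite sg ltnS (leq_trans (size_scale_leq _ _)) // (leq_trans sl).
by rewrite size_polyDl // sg eqxx andbT monicE lead_coefDl.
Qed.

Definition polys_le n : seq {poly F} := [seq rVpoly v | v : 'rV[F]_n].

Lemma mem_polys_le n g : (g \in polys_le n) = (size g <= n)%N.
Proof.
apply/imageP/idP => [[v _ ->]|sg]; first exact: size_poly.
by exists (poly_rV g) => //; rewrite poly_rV_K.
Qed.

Lemma polys_le_uniq n : uniq (polys_le n).
Proof. rewrite map_inj_uniq ?enum_uniq //; exact: (can_inj (@rVpolyK _ _)). Qed.

Lemma polys_leS n :
  perm_eq (polys_le n.+1)
    (polys_le n ++ [seq c *: g | c <- [seq c <- index_enum F | c != 0], g <- monics F n]).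
Proof.
have sz (c : F) g : c != 0 -> g \in monics F n -> size (c *: g) = n.+1.
  by move=> c0; rewrite mem_monics => /andP[_ /eqP <-]; rewrite size_scale.
apply: uniq_perm; first exact: polys_le_uniq.
  rewrite cat_uniq polys_le_uniq /=; apply/andP; split.
    apply/hasPn => g /allpairsP[[c h] /= []]; rewrite mem_filter => /andP[c0 _] hm ->.
    by rewrite mem_polys_le sz // ltnn.
  apply: allpairs_uniq; rewrite ?filter_uniq ?index_enum_uniq ?monics_uniq //.
  move=> [c g] [d h] /allpairsP[[c1 g1] /= []]; rewrite mem_filter => /andP[c0 _] gm [-> ->].
  case/allpairsP=> [[d1 h1] /= []]; rewrite mem_filter => /andP[d0 _] hm [-> ->] eqcd.
  have := congr1 (fun p : {poly F} => lead_coef p) eqcd; rewrite !lead_coefZ.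
  move: gm hm; rewrite !mem_monics => /andP[/monicP -> _] /andP[/monicP -> _].
  by rewrite !mulr1 => cd; move: eqcd; rewrite cd => /(scalerI d0) ->.
move=> g; rewrite mem_cat !mem_polys_le leq_eqVlt ltnS orbC; congr (_ || _).
apply/eqP/allpairsP => [sg|[[c h] /= []]]; last first.
  by rewrite mem_filter => /andP[c0 _] hm ->; rewrite sz.
have g0 : g != 0 by rewrite -size_poly_gt0 sg.
have lg0 : lead_coef g != 0 by rewrite lead_coef_eq0.
exists (lead_coef g, (lead_coef g)^-1 *: g); split=> /=.
- by rewrite mem_filter lg0 mem_index_enum.
- by rewrite mem_monics monicE lead_coefZ mulVf // size_scale ?invr_eq0 // sg !eqxx.
by rewrite scalerA mulfV // scale1r.
Qed.

(* If the product of the characters is trivial then chi is invariant under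
   scaling, so it can be summed over all polynomials of degree < m instead of the
   monic ones.  The resulting zero T = 1 of L is the point at infinity. *)
Lemma kummer_coef_sum0 :
  (0 < m)%N -> (r %| \sum_i e i)%N -> \sum_(n < m) lfun_coef chi n = 0.
Proof.
move=> m0 re; have [i0 i0s] := card_gt0P m0.
have chi0 : chi 0 = 0.
  rewrite /kummer_char (bigD1 i0) //= horner0 expr0n gtn_eqF ?(cofactor_gt0 cardF) //=.
  rewrite (unity_char0 w (node_prim z0_prim cardF)) expr0n.
  by move: i0s; rewrite inE => /negPf ->; rewrite mul0r.
have chiZ c g : c != 0 -> chi (c *: g) = chi g.
  move=> c0; rewrite -mul_polyC (kummer_charM e z0_prim cardF w_prim).
  suff -> : chi c%:P = 1 by rewrite mul1r.
  rewrite /kummer_char; under eq_bigr do rewrite hornerC; rewrite prodrXr.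
  have zp := node_prim z0_prim cardF.
  have [|[i ->]] := unity0P zp (unity0_exps cardF c).
    by move/eqP; rewrite expf_eq0 (negPf c0) andbF.
  by apply/eqP; rewrite (unity_charX w_prim zp) -exprM -(prim_order_dvd w_prim) dvdn_mull.
have sumE n : \sum_(g <- polys_le n) chi g
    = (q.-1)%:R * \sum_(j < n) lfun_coef chi j.
  elim: n => [|n IHn].
    rewrite big_ord0 mulr0 big_seq big1 // => g; rewrite mem_polys_le leqn0.
    by rewrite size_poly_eq0 => /eqP ->.
  rewrite (perm_big _ (polys_leS n)) big_cat /= IHn big_ord_recr mulrDr.
  congr (_ + _); rewrite big_allpairs_dep /=.
  rewrite big_seq (eq_bigr (fun=> lfun_coef chi n)); last first.
    by move=> c; rewrite mem_filter => /andP[c0 _]; apply: eq_bigr => g _; rewrite chiZ.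
  rewrite -big_seq big_const_seq iter_addr_0 count_predT size_filter mulr_natl.
  congr (_ *+ _); rewrite -sum1_count -(cardC1 (0 : F)) -sum1_card.
  by apply: eq_bigl => c; rewrite !inE.
have := sumE m; have [l [sl l1 l0]] := lagrange_node i0s.
rewrite (kummer_twist_sum (polys_le_uniq m) i0s l1 l0) => [/esym/eqP|g c].
  rewrite mulf_eq0 pnatr_eq0 gtn_eqF ?(prim_order_gt0 z0_prim) //=.
  by move/eqP.
rewrite !mem_polys_le => sg; rewrite (leq_trans (size_polyD _ _)) // geq_max sg.
by rewrite (leq_trans (size_scale_leq _ _)).
Qed.

End KummerVanishing.

Lemma sum_expr_unity (C : idomainType) (r : nat) (y : C) :
  y ^+ r = 1 -> \sum_(i < r) y ^+ i = if y == 1 then r%:R else 0.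
Proof.
move=> yr; case: eqVneq => [->|y1].
  by under eq_bigr do rewrite expr1n; rewrite sumr_const card_ord.
have := subrX1 y r; rewrite yr subrr => /esym/eqP.
by rewrite mulf_eq0 subr_eq0 (negPf y1) => /eqP.
Qed.

Lemma sum_prim_root (R : idomainType) (n : nat) (x : R) :
  n.-primitive_root x -> (1 < n)%N -> \sum_(i < n) x ^+ i = 0.
Proof.
move=> xn n1; rewrite sum_expr_unity ?prim_expr_order //.
by rewrite -[x]expr1 -(prim_order_dvd xn) gtnNdvd.
Qed.

(* Upper bounds for all the fibres A j, together with their total, force lower
   bounds. *)
Lemma norm_sum_equidistributed (R : numDomainType) (d N Q M : nat) (eta : R) (A : 'I_d -> nat) :
  d.-primitive_root eta -> (1 < d)%N ->
  (forall j, d * A j <= Q + N)%N -> (Q <= \sum_j A j + M)%N ->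
  `|\sum_(j < d) eta ^+ j * (A j)%:R| <= (N + M)%:R.
Proof.
move=> eta_prim d1 leA leQ; have d0 : (0 < d)%N by apply: ltnW.
rewrite -(ler_pM2l (x := d%:R)) ?ltr0n // -{1}[d%:R]normr_nat -normrM mulr_sumr.
(* As the [eta ^+ j] sum to zero, [d * A j] may be traded for its deficit from [Q + N]; the deficits
   are nonnegative with total at most [d * (N + M)]. *)
have -> : \sum_(j < d) d%:R * (eta ^+ j * (A j)%:R)
    = - \sum_(j < d) eta ^+ j * (Q + N - d * A j)%:R.
  transitivity (\sum_(j < d) (eta ^+ j * (Q + N)%:R
                              - eta ^+ j * (Q + N - d * A j)%:R)).
    by apply: eq_bigr => j _; rewrite natrB // natrM; ring.
  by rewrite sumrB -mulr_suml sum_prim_root // mul0r sub0r.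
rewrite normrN (le_trans (ler_norm_sum _ _ _)) //.
have eta1 j : `|eta ^+ j| = 1.
  apply/eqP; rewrite -(@pexpr_eq1 _ _ d) // -normrX -exprM mulnC exprM.
  by rewrite (prim_expr_order eta_prim) expr1n normr1.
rewrite (eq_bigr (fun j : 'I_d => (Q + N - d * A j)%:R)); last first.
  by move=> j _; rewrite normrM eta1 mul1r normr_nat.
rewrite -natr_sum -natrM ler_nat sumnB // sum_nat_const card_ord -big_distrr /=.
by rewrite leq_subLR -mulnDr leq_mul2l addnC addnCA leq_add2l leQ orbT.
Qed.

Lemma cards_sum (T : finType) (P : pred T) :
  (#|[set x | P x]| = \sum_x P x)%N.
Proof.
by rewrite -sum1_card big_mkcond; apply: eq_bigr => x _; rewrite inE; case: (P x).
Qed.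

Lemma mup_prod_subX (L : fieldType) (I : finType) (b : I -> L) (e : I -> nat) i :
  injective b -> mup (b i) (\prod_j ((b j)%:P - 'X) ^+ e j) = e i.
Proof.
move=> b_inj; rewrite (bigD1 i) //= mupMl; last first.
  rewrite /root horner_prod; apply/prodf_neq0 => j ji.
  rewrite horner_exp expf_neq0 // hornerD hornerN hornerC hornerX subr_eq0.
  by rewrite (inj_eq b_inj).
rewrite -opprB exprNn mupMr; first by rewrite mup_XsubCX eqxx.
by rewrite -polyCN -polyC_exp /root hornerC expf_neq0 // oppr_eq0 oner_eq0.
Qed.

Lemma predn_exp_succ q k : (0 < q)%N ->
  (q ^ k = (q.-1 * \sum_(i < k) q ^ i).+1)%N.
Proof. by move=> q0; rewrite -predn_exp prednK // expn_gt0 q0. Qed.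

Section KummerStepanov.

Variables (F : finFieldType) (r s : nat) (z0 : F) (w : algC) (e : 'I_r -> nat).
Hypothesis z0_prim : (#|F|.-1).-primitive_root z0.
Hypothesis cardF : #|F| = (r * s).+1.
Hypothesis w_prim : r.-primitive_root w.
Hypothesis e_lt : forall i, (e i < r)%N.
Hypothesis supp_gt0 : (0 < #|kummer_supp e|)%N.
Local Notation q := #|F|.
Local Notation z := (z0 ^+ s).
Local Notation chi := (kummer_char s z0 w e).

Definition kummer_poly : {poly F} := \prod_(i < r) ((z ^+ i)%:P - 'X) ^+ e i.

(** [d] is the order of the vector [e] modulo [r]. The last clause supplies the multiplicity
    hypothesis of [frobenius_independence]. *)
Lemma kummer_order :
  exists d, [/\ (1 < d)%N, (d %| r)%N, forall i, (r %| d * e i)%N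
    & forall j, (0 < j < d)%N -> exists i, ~~ (r %| j * e i)%N].
Proof.
have r_gt0 := prim_order_gt0 w_prim.
pose P d := (0 < d)%N && [forall i : 'I_r, (r %| d * e i)%N].
have exP : exists d, P d.
  by exists r; rewrite /P r_gt0; apply/forallP => i; rewrite dvdn_mulr.
case: (ex_minnP exP) => d /andP[d0 /forallP rd] mind; exists d; split=> //.
- rewrite ltn_neqAle d0 andbT; apply/eqP => d1; move: supp_gt0 => /card_gt0P[i].
  rewrite inE => ei; have := rd i; rewrite -d1 mul1n gtnNdvd ?lt0n //.
- apply/eqP; apply: contraTeq (ltn_pmod r d0); rewrite -leqNgt => rm.
  apply: mind; rewrite /P lt0n rm /=; apply/forallP => i.
  rewrite -(dvdn_addr _ (dvdn_mull (r %/ d) (rd i))) mulnA -mulnDl -divn_eq.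
  by rewrite dvdn_mulr.
move=> j /andP[j0 jd]; apply/existsP; rewrite -negb_forall.
apply/negP => /forallP rj; have := mind j; rewrite leqNgt jd.
by move=> H; have := H _; rewrite /P j0 /=; case/(_ _)/negP; [apply/forallP|].
Qed.

Lemma kummer_stepanov :
  exists C t0, forall (K : finFieldType) (iota : {rmorphism F -> K}) t,
    (t0 <= t)%N -> #|K| = (q ^ (2 * t))%N ->
    `|lfun_sum chi (2 * t)| <= C%:R * q%:R ^+ t.
Proof.
have [d [d1 dr rd nrd]] := kummer_order.
have zp := node_prim z0_prim cardF; have r_gt0 := prim_order_gt0 w_prim.
have sgt0 := cofactor_gt0 cardF.
pose sf := size kummer_poly.
pose c1 := stepanov_const q s d sf.
(* The first summand is the error of [stepanov_bound], the last bounds the zeros of [f]; [t0] gives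
   [2 * (d + c1) <= q ^ t] through [t < q ^ t]. *)
exists (2 * (c1 + d * sf) + sf)%N, (2 * (d + c1)).+1 => K iota t t0 cardK.
have t_gt0 : (0 < 2 * t)%N by rewrite muln_gt0 /=; apply: leq_trans t0.
rewrite (kummer_sum_extension e z0_prim cardF w_prim iota t_gt0 cardK).
set h := (s * _)%N.
pose f := map_poly iota kummer_poly.
have fP : f = \prod_(i < r) ((iota z ^+ i)%:P - 'X) ^+ e i.
  rewrite /f rmorph_prod; apply: eq_bigr => i _ /=.
  by rewrite [LHS]rmorphXn rmorphB /= map_polyC map_polyX /= [iota (_ ^+ i)]rmorphXn.
have fE x : f.[x] = \prod_(i < r) (iota z ^+ i - x) ^+ e i.
  rewrite fP horner_prod; apply: eq_bigr => i _.
  by rewrite horner_exp hornerD hornerN hornerX hornerC.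
have Qr : (q ^ (2 * t))%N = (r * h).+1.
  have qr : q.-1 = (r * s)%N by rewrite cardF.
  by rewrite predn_exp_succ ?(ltnW (card_finNzRing_gt1 F)) // qr mulnA.
have zKp : r.-primitive_root (iota z) by rewrite fmorph_primitive_root.
have q_gt1 := card_finNzRing_gt1 F.
have h_gt0 : (0 < h)%N.
  have : (1 < q ^ (2 * t))%N by rewrite -(expn0 q) ltn_exp2l.
  by rewrite Qr ltnS muln_gt0 => /andP[].
have xrh (x : K) : x != 0 -> x ^+ (h * r) = 1.
  move=> x0; apply: (mulIf x0); rewrite -exprSr mulnC -Qr -cardK expf_card.
  by rewrite mul1r.
have u0 (x : K) : unity0 r (x ^+ h).
  rewrite /unity0 expf_eq0 h_gt0 -exprM /=.
  by case: (eqVneq x 0) => //= x0; rewrite xrh.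
have -> : \sum_x \prod_(i < r) unity_char r (iota z) w ((iota z ^+ i - x) ^+ h) ^+ e i
    = \sum_x unity_char r (iota z) w (f.[x] ^+ h).
  apply: eq_bigr => x _; rewrite fE -prodrXl (unity_char_prod w_prim zKp).
    apply: eq_bigr => i _.
    by rewrite -(unity_char_exp w_prim zKp) ?u0 // -!exprM [(h * _)%N]mulnC.
  by move=> i; rewrite -exprM mulnC exprM unity0_exp.
(* Off the zeros of [f], the value [f.[x] ^+ h] is a d-th root of unity because [r] divides every
   [d * e i]; so there are only [d] fibres. *)
pose zeta := iota z ^+ (r %/ d); pose eta := w ^+ (r %/ d).
pose A (j : 'I_d) := #|[set x | f.[x] ^+ h == zeta ^+ j]|.
have zetap : d.-primitive_root zeta by apply: dvdn_prim_root.
have etap : d.-primitive_root eta by apply: dvdn_prim_root.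
have zeta0 := prim_root_neq0 zetap.
have part x : f.[x] != 0 ->
    exists j0 : 'I_d, forall j : 'I_d, (f.[x] ^+ h == zeta ^+ j) = (j == j0).
  move=> fx0; have /(prim_rootP zetap)[j0 j0E] : (f.[x] ^+ h) ^+ d = 1.
    rewrite fE -!prodrXl big1 // => i _.
    have : (iota z ^+ i - x) ^+ e i != 0.
      by move: fx0; rewrite fE => /prodf_neq0; apply.
    have [-> _|ei] := posnP (e i); first by rewrite !expr1n.
    rewrite expf_eq0 ei /= => ui; have /dvdnP[l lE] := rd i.
    rewrite -!exprM (_ : (e i * (h * d) = h * r * l)%N); last first.
      by rewrite mulnCA [(e i * d)%N]mulnC lE [(l * r)%N]mulnC mulnA.
    by rewrite exprM xrh // expr1n.
  exists j0 => j; rewrite j0E (eq_prim_root_expr zetap) !modn_small //.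
  by rewrite eq_sym val_eqE.
have -> : \sum_x unity_char r (iota z) w (f.[x] ^+ h)
    = \sum_(j < d) eta ^+ j * (A j)%:R.
  transitivity (\sum_x \sum_(j < d) eta ^+ j * (f.[x] ^+ h == zeta ^+ j)%:R).
    apply: eq_bigr => x _; have [fx|/part[j0 j0E]] := eqVneq f.[x] 0.
      rewrite fx expr0n gtn_eqF // (unity_char0 w zKp) big1 // => j _.
      by rewrite eq_sym (negPf (expf_neq0 _ zeta0)) mulr0.
    rewrite (bigD1 j0) //= j0E eqxx mulr1 big1 => [|j /negPf jj0]; last first.
      by rewrite j0E jj0 mulr0.
    have /eqP -> : f.[x] ^+ h == zeta ^+ j0 by rewrite j0E.
    by rewrite addr0 /zeta -exprM (unity_charX w_prim zKp) exprM.
  rewrite exchange_big; apply: eq_bigr => j _ /=; rewrite -mulr_sumr -natr_sum.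
  by rewrite /A cards_sum.
have fK0 : f != 0.
  rewrite map_poly_eq0; apply/prodf_neq0 => i _; apply: expf_neq0.
  by rewrite -opprB oppr_eq0 polyXsubC_eq0.
have sfK : size f = sf by rewrite size_map_poly.
apply: le_trans (_ : (2 * (c1 + d * sf) * q ^ t + sf)%N%:R <= _).
  apply: (norm_sum_equidistributed (Q := (q ^ (2 * t))%N)) => // [j|].
    have Q2 : (q ^ (2 * t) = (q ^ t) ^ 2)%N by rewrite mulnC expnM.
    have pqi := pnat_pchar_base t_gt0 cardK.
    rewrite Q2 /c1 -sfK; apply: (stepanov_bound (r := r) (h0 := s)
      (h' := (s * \sum_(i < t) q ^ i)%N)) => //.
    - by rewrite -[q]expn1 pqi.
    - have qr : q.-1 = (r * s)%N by rewrite cardF.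
      by rewrite {1}predn_exp_succ ?(ltnW q_gt1) // qr mulnA.
    - by rewrite cardK Q2.
    - by rewrite -Q2.
    - rewrite sfK -/c1 (leq_trans (ltnW t0)) // ltnW // ltn_expl //.
    - by rewrite (ltnW d1) dvdn_leq.
    - rewrite fE; apply/prodf_neq0 => i _; rewrite subr0 !expf_neq0 //.
      exact: prim_root_neq0 zKp.
    - move=> ee /nrd[i nri]; exists (iota z ^+ i); apply: contra nri.
      suff -> : mup (iota z ^+ i) f = e i by [].
      rewrite fP (mup_prod_subX (b := fun j : 'I_r => iota z ^+ j)) // => i1 i2.
      by move/eqP; rewrite (eq_prim_root_expr zKp) !modn_small // => /eqP/val_inj.
    - by rewrite expf_neq0.
  rewrite -cardK -sum1_card.
  have -> : (\sum_j A j = \sum_x (f.[x] != 0%R))%N.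
    rewrite /A; under eq_bigr do rewrite cards_sum.
    rewrite exchange_big; apply: eq_bigr => x _ /=.
    have [fx|/part[j0 j0E]] := eqVneq f.[x] 0.
      rewrite big1 // => j _; rewrite fx expr0n gtn_eqF //=.
      by rewrite eq_sym (negPf (expf_neq0 _ zeta0)).
    rewrite (bigD1 j0) //= j0E eqxx big1 // => j /negPf jj0.
    by rewrite j0E jj0.
  have : (\sum_x (f.[x] == 0%R) <= sf)%N.
    rewrite -cards_sum -sfK cardE ltnW //; apply: max_poly_roots => //.
      by apply/allP => x; rewrite mem_enum inE.
    exact: enum_uniq.
  move=> /(leq_add (leqnn (\sum_x (f.[x] != 0%R)))); apply: leq_trans.
  by rewrite -big_split /= leq_sum // => x _; case: eqP.
rewrite -natrX -natrM ler_nat mulnDl leq_add2l leq_pmulr //.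
by rewrite expn_gt0 ltnW.
Qed.

End KummerStepanov.

Lemma norm_sum_le_size (C : numDomainType) (R : seq C) (b : C) n :
  {in R, forall x, `|x| <= b} -> 0 <= b -> (size R <= n)%N ->
  `|\sum_(x <- R) x| <= n%:R * b.
Proof.
move=> Rb b0 sR; apply: (@le_trans _ _ ((size R)%:R * b)); last first.
  by rewrite ler_wpM2r // ler_nat.
elim: R Rb {sR} => [|x R IHR] Rb; first by rewrite big_nil normr0 mul0r.
rewrite big_cons /= -natr1 mulrDl mul1r addrC (le_trans (ler_normD _ _)) //.
rewrite lerD ?Rb ?mem_head // IHR // => y yR.
by rewrite Rb // in_cons yR orbT.
Qed.

Section KummerWeil.

Variables (F : finFieldType) (r s : nat) (z0 : F) (w : algC) (e : 'I_r -> nat).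
Hypothesis z0_prim : (#|F|.-1).-primitive_root z0.
Hypothesis cardF : #|F| = (r * s).+1.
Hypothesis w_prim : r.-primitive_root w.
Hypothesis e_lt : forall i, (e i < r)%N.
Hypothesis supp_gt0 : (0 < #|kummer_supp e|)%N.
Local Notation q := #|F|.
Local Notation z := (z0 ^+ s).
Local Notation chi := (kummer_char s z0 w e).
Local Notation m := #|kummer_supp e|.

Definition kummer_sum : algC :=
  \sum_(a : F) \prod_(i < r) unity_char r z w ((z ^+ i - a) ^+ s) ^+ e i.

Lemma kummer_sum_roots :
  exists2 R : seq algC, {in R, forall x, `|x| <= sqrtC q%:R} &
    [/\ (size R <= m.-1)%N, kummer_sum = - \sum_(x <- R) x
      & (r %| \sum_i e i)%N -> 1 \in R].
Proof.
have [||n|R [sR SR R1]] := @newton_roots algC (lfun_coef chi) (lfun_sum chi) m.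
- by rewrite /lfun_coef monics0 big_seq1 (kummer_char1 e z0_prim cardF w_prim).
- by move=> n; apply: kummer_coef_eq0.
- apply: lfun_newton; first exact: (kummer_char1 e z0_prim cardF w_prim).
  exact: (kummer_charM e z0_prim cardF w_prim).
exists R; last first.
  split=> // [|re]; last by apply: R1; apply: kummer_coef_sum0.
  transitivity (lfun_sum chi 1); last by rewrite SR.
  have := kummer_sum_extension e z0_prim cardF w_prim (k := 1)
    (idfun : {rmorphism F -> F}) isT (esym (expn1 _)).
  by rewrite big_ord1 expn0 muln1 => ->.
have [C [t0 bound]] := kummer_stepanov z0_prim cardF w_prim e_lt supp_gt0.
have q_gt0 : 0 < q%:R :> algC by rewrite ltr0n ltnW // card_finNzRing_gt1.
(* Only sums of even degree are controlled; these are power sums of the squares of the roots, which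
   suffices. *)
have growth : {in [seq x ^+ 2 | x <- R], forall x, `|x| <= q%:R}.
  apply: (power_sum_growth (c := C%:R) (t0 := t0.+1)) => // t t0t.
  have t_gt0 : (0 < 2 * t)%N by rewrite muln_gt0 /=; apply: leq_trans t0t.
  have [K [iota cardK]] := exists_finite_extension F t_gt0.
  have := bound K iota t (ltnW t0t) cardK; rewrite SR // normrN.
  congr (`|_| <= _); rewrite big_map; apply: eq_bigr => x _.
  by rewrite exprM.
move=> x xR; rewrite -(@ler_pXn2r _ 2) // ?nnegrE ?sqrtC_ge0 ?(ltW q_gt0) //.
rewrite sqrtCK -normrX.
by have := growth _ (map_f (fun y => y ^+ 2) xR).
Qed.

Lemma kummer_weil : `|kummer_sum| <= m.-1%:R * sqrtC q%:R.
Proof.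
have [R Rq [sR -> _]] := kummer_sum_roots; rewrite normrN.
by apply: norm_sum_le_size => //; rewrite sqrtC_ge0 ler0n.
Qed.

(** The reciprocal root 1 is the added term on the left; at most [m.-2] roots remain. *)
Lemma kummer_weil_projective :
  (r %| \sum_i e i)%N -> `|kummer_sum + 1| <= m.-2%:R * sqrtC q%:R.
Proof.
have [R Rq [sR -> R1]] := kummer_sum_roots; move=> /R1 oneR.
rewrite (big_rem 1) //= opprD addrAC addNr add0r normrN.
apply: norm_sum_le_size => [x /mem_rem/Rq //||]; first by rewrite sqrtC_ge0 ler0n.
by rewrite size_rem // -!subn1 leq_sub2r // subn1.
Qed.

End KummerWeil.

(** * Counting by characters *)

Lemma prod_sum_powers (C : comNzRingType) (J : finType) (r : nat) (y : J -> C) :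
  \prod_j \sum_(x < r) y j ^+ x
  = \sum_(e : {ffun J -> 'I_r}) \prod_j y j ^+ e j.
Proof. by rewrite bigA_distr_bigA. Qed.

(** A sum over [u] detects the divisibility; the sum over [e] then factors over [j], and each factor
    is [r] or 0. *)
Lemma sum_ffun_dvd (C : idomainType) (r : nat) (w : C) (t : 'I_r -> nat) :
  r.-primitive_root w ->
  r%:R * (\sum_(e : {ffun 'I_r -> 'I_r} | (r %| \sum_j e j)%N)
            \prod_j (w ^+ t j) ^+ e j)
  = (r ^ r * #|[set u : 'I_r | [forall j, (r %| u + t j)%N]]|)%N%:R.
Proof.
move=> wp; have wr := prim_expr_order wp.
transitivity (\sum_(e : {ffun 'I_r -> 'I_r}) \sum_(u < r)
    \prod_j (w ^+ (u + t j)) ^+ e j).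
  rewrite mulr_sumr big_mkcond; apply: eq_bigr => e _.
  transitivity (\sum_(u < r) (w ^+ (\sum_j e j)) ^+ u * \prod_j (w ^+ t j) ^+ e j).
    rewrite -mulr_suml sum_expr_unity; last by rewrite -exprM mulnC exprM wr expr1n.
    by rewrite -(prim_order_dvd wp); case: ifP => _; rewrite ?mul0r.
  apply: eq_bigr => u _; rewrite -exprM mulnC exprM -prodrXr -big_split /=.
  by apply: eq_bigr => j _; rewrite -exprMn -exprD.
rewrite exchange_big cards_sum big_distrr natr_sum; apply: eq_bigr => u _ /=.
rewrite -prod_sum_powers.
under eq_bigr => j _.
  rewrite sum_expr_unity; last by rewrite -exprM mulnC exprM wr expr1n.
  rewrite -(prim_order_dvd wp).
  over.
case: (boolP [forall j, _]) => [/forallP ru|].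
  under eq_bigr do rewrite ru; rewrite prodr_const card_ord muln1 natrX //.
rewrite negb_forall => /existsP[j rj]; rewrite (bigD1 j) //= (negPf rj).
by rewrite mul0r muln0.
Qed.

Lemma card_ffun_dvd (r : nat) : (0 < r)%N ->
  #|[set e : {ffun 'I_r -> 'I_r} | (r %| \sum_j e j)%N]| = (r ^ r.-1)%N.
Proof.
move=> r0; have [w wp] := C_prim_root_exists r0.
have := sum_ffun_dvd (fun=> 0%N) wp.
rewrite (eq_bigr (fun=> 1)) => [|e _]; last first.
  by rewrite big1 // => j _; rewrite expr0 expr1n.
have -> : [set u : 'I_r | [forall j : 'I_r, (r %| u + 0)%N]] = [set Ordinal r0].
  apply/setP => u; rewrite !inE -val_eqE /=; apply/forallP/eqP => [/(_ u)|-> j].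
    by rewrite addn0; have [//|u0] := posnP u; rewrite gtnNdvd // ltn_ord.
  by rewrite dvdn0.
rewrite cards1 muln1 sumr_const -natrM => /eqP; rewrite eqr_nat => /eqP.
move=> cardE; apply/eqP; rewrite -(eqn_pmul2l r0) -expnS prednK //; apply/eqP.
by rewrite -[RHS]cardE; congr (_ * _)%N; apply: eq_card => e; rewrite inE.
Qed.

Lemma sum_card_supp (r : nat) : (0 < r)%N ->
  (\sum_(e : {ffun 'I_r -> 'I_r}) #|[set i | e i != 0%N :> nat]|
    = r * (r.-1 * r ^ r.-1))%N.
Proof.
move=> r0; have sumj (j : 'I_r) :
    (\sum_(e : {ffun 'I_r -> 'I_r}) (e j != 0%N :> nat) = r.-1 * r ^ r.-1)%N.
  transitivity (\sum_(e : {ffun 'I_r -> 'I_r}) \prod_i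
      (if i == j then nat_of_bool (e i != 0%N :> nat) else 1))%N.
    apply: eq_bigr => e _; rewrite (bigD1 j) //= eqxx big1 ?muln1 //.
    by move=> i /negPf ->.
  rewrite -(bigA_distr_bigA (fun i (x : 'I_r) =>
    if i == j then nat_of_bool (x != 0%N :> nat) else 1%N)) /=.
  rewrite (bigD1 j) //= eqxx; congr (_ * _)%N.
    rewrite -cards_sum -[in RHS](card_ord r) -(cardC1 (Ordinal r0)).
    by apply: eq_card => x; rewrite !inE -val_eqE.
  rewrite (eq_bigr (fun=> r)) => [|i /negPf ->]; last first.
    by rewrite sum1_card card_ord.
  by rewrite prod_nat_const cardC1 card_ord.
under eq_bigr do rewrite cards_sum.
rewrite exchange_big /= (eq_bigr _ (fun j _ => sumj j)).
by rewrite sum_nat_const card_ord.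
Qed.

Section PatternCount.

Variables (F : finFieldType) (r s : nat) (z0 : F) (t : 'I_r -> nat).
Hypothesis z0_prim : (#|F|.-1).-primitive_root z0.
Hypothesis cardF : #|F| = (r * s).+1.
Local Notation q := #|F|.
Local Notation z := (z0 ^+ s).

(** Prescribes [(z ^+ j + a) ^+ s] as the inverse of [z ^+ t j]. *)
Definition pattern_set : {set F} :=
  [set a : F | [forall j : 'I_r, (z ^+ j + a) ^+ s * z ^+ t j == 1]].

Let r_gt0 : (0 < r)%N := prim_order_gt0 (node_prim z0_prim cardF).

Let e0 : {ffun 'I_r -> 'I_r} := [ffun=> Ordinal r_gt0].

(* The product of the weights over j is the number of points over a on the curve
   y_j ^ r = (z ^+ j + a) * z0 ^+ t j (0 <= j < r). *)
Definition pattern_weight (a : F) (j : 'I_r) : nat :=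
  if z ^+ j + a == 0 then 1%N
  else if (z ^+ j + a) ^+ s * z ^+ t j == 1 then r else 0%N.

(** The branch points [a = - z ^+ j] lie outside [pattern_set]; there one factor is 1 and the others
    are at most [r]. *)
Lemma prod_pattern_weight (a : F) :
  (r ^ r * (a \in pattern_set) <= \prod_j pattern_weight a j
   <= r ^ r * (a \in pattern_set) + \sum_(j < r) ((z ^+ j + a)%R == 0%R) * r ^ r.-1)%N.
Proof.
have s_pos := cofactor_gt0 cardF.
case: (boolP [exists j : 'I_r, z ^+ j + a == 0]) => [/existsP[j0 j0a]|].
  have -> : (a \in pattern_set) = false.
    apply/negP; rewrite inE => /forallP/(_ j0).
    by rewrite (eqP j0a) expr0n gtn_eqF //= mul0r eq_sym oner_eq0.
  rewrite muln0 leq0n add0n (bigD1 j0) //= [X in (_ <= X)%N](bigD1 j0) //=.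
  rewrite {1}/pattern_weight j0a !mul1n; apply: leq_trans (leq_addr _ _).
  have <- : (\prod_(i < r | i != j0) r = r ^ r.-1)%N.
    by rewrite prod_nat_const cardC1 card_ord.
  apply: leq_prod => i _; rewrite /pattern_weight.
  by case: ifP => // _; case: ifP.
rewrite negb_exists => /forallP nz.
rewrite [X in (_ + X)%N]big1 ?addn0 => [|j _]; last by rewrite (negPf (nz j)).
suff -> : (\prod_j pattern_weight a j = r ^ r * (a \in pattern_set))%N.
  by rewrite leqnn.
rewrite inE; case: (boolP [forall j, _]) => [/forallP eq1|].
  rewrite (eq_bigr (fun=> r)) => [|j _]; last by rewrite /pattern_weight (negPf (nz j)) eq1.
  by rewrite prod_nat_const card_ord muln1.
rewrite negb_forall => /existsP[j jn]; rewrite (bigD1 j) //=.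
by rewrite /pattern_weight (negPf (nz j)) (negPf jn) mul0n muln0.
Qed.

Lemma sum_pattern_weight :
  (r ^ r * #|pattern_set| <= \sum_a \prod_j pattern_weight a j
   <= r ^ r * #|pattern_set| + r * r ^ r.-1)%N.
Proof.
have -> : (r ^ r * #|pattern_set| = \sum_a r ^ r * (a \in pattern_set))%N.
  by rewrite -big_distrr /= -cards_sum; congr (_ * _)%N; apply: eq_card => a; rewrite inE.
apply/andP; split; first by apply: leq_sum => a _; case/andP: (prod_pattern_weight a).
have -> : (r * r ^ r.-1 = \sum_(a : F) \sum_(j < r) ((z ^+ j + a)%R == 0%R) * r ^ r.-1)%N.
  rewrite exchange_big /= (eq_bigr (fun=> r ^ r.-1)%N) => [|j _].
    by rewrite sum_nat_const card_ord.
  rewrite -big_distrl /= -cards_sum (_ : [set _ | _] = [set - z ^+ j]).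
    by rewrite cards1 mul1n.
  by apply/setP => a; rewrite !inE addrC addr_eq0.
rewrite -big_split /=; apply: leq_sum => a _.
by case/andP: (prod_pattern_weight a).
Qed.

Section Complex.

Variable w : algC.
Hypothesis w_prim : r.-primitive_root w.
Local Notation rho := (unity_char r z w).

Lemma pattern_weight_charE a (j : 'I_r) :
  \sum_(x < r) (rho ((z ^+ j + a) ^+ s) * w ^+ t j) ^+ x
  = (pattern_weight a j)%:R.
Proof.
have zp := node_prim z0_prim cardF; have s_pos := cofactor_gt0 cardF.
rewrite /pattern_weight; case: eqVneq => [->|ja0].
  (* At a branch point only the exponent 0 survives, since [0 ^+ 0 = 1]; hence the weight 1. *)
  rewrite expr0n gtn_eqF //= (unity_char0 w zp) mul0r.
  rewrite (bigD1 (Ordinal r_gt0)) //= big1 ?addr0 // => x.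
  by rewrite -val_eqE expr0n /= => /negPf ->.
have [|[i ->]] := unity0P zp (unity0_exps cardF (z ^+ j + a)).
  by move/eqP; rewrite expf_eq0 (negPf ja0) andbF.
rewrite (unity_charX w_prim zp) -!exprD -(prim_order_dvd zp).
rewrite sum_expr_unity; last first.
  by rewrite -exprM mulnC exprM (prim_expr_order w_prim) expr1n.
by rewrite -(prim_order_dvd w_prim); case: ifP.
Qed.

Definition pattern_coef (e : {ffun 'I_r -> 'I_r}) : algC :=
  \prod_j (w ^+ t j) ^+ e j.

Lemma pattern_weight_expand :
  (\sum_a \prod_j pattern_weight a j)%N%:R
  = \sum_(e : {ffun 'I_r -> 'I_r})
      pattern_coef e * kummer_sum s z0 w (fun i => e i).
Proof.
rewrite natr_sum.
transitivity (\sum_(a : F) \sum_(e : {ffun 'I_r -> 'I_r}) \prod_(j < r)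
   (rho ((z ^+ j + a) ^+ s) * w ^+ t j) ^+ e j).
  apply: eq_bigr => a _; rewrite natr_prod -prod_sum_powers.
  by apply: eq_bigr => j _; rewrite pattern_weight_charE.
rewrite exchange_big; apply: eq_bigr => e _ /=.
(* [kummer_sum] involves [z ^+ i - a], the pattern [z ^+ j + a]. *)
rewrite /kummer_sum mulr_sumr (reindex_inj oppr_inj); apply: eq_bigr => a _ /=.
by rewrite -big_split; apply: eq_bigr => j _ /=; rewrite exprMn mulrC.
Qed.

Lemma norm_pattern_coef e : `|pattern_coef e| = 1.
Proof.
rewrite normr_prod big1 // => j _; apply/eqP.
rewrite -(@pexpr_eq1 _ _ r) // -normrX -!exprM mulnC exprM.
by rewrite (prim_expr_order w_prim) expr1n normr1.
Qed.

Lemma kummer_sum_eq0 : kummer_sum s z0 w (fun i => e0 i) = q%:R.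
Proof.
rewrite /kummer_sum (eq_bigr (fun=> 1)) => [|a _]; last first.
  by rewrite big1 // => i _; rewrite ffunE expr0.
by rewrite sumr_const.
Qed.

(* Truncated subtraction is harmless for e != e0, by [kummer_supp_ge]. *)
Definition weil_genus (e : {ffun 'I_r -> 'I_r}) : nat :=
  (#|kummer_supp (fun i => e i)| - (1 + (r %| \sum_i e i)))%N.

(** A single exponent strictly between 0 and [r] is not divisible by [r], so the divisible case has
    at least two nonzero exponents. *)
Lemma kummer_supp_ge e : e != e0 ->
  (1 + (r %| \sum_i e i) <= #|kummer_supp (fun i => e i)|)%N.
Proof.
move=> ee0; have [i ei] : exists i, e i != 0%N :> nat.
  apply/existsP; rewrite -negb_forall; apply: contra ee0 => /forallP ez.
  by apply/eqP/ffunP => i; rewrite ffunE; apply/val_inj/eqP/ez.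
have iin : i \in kummer_supp (fun i => e i) by rewrite inE.
have [re|] := boolP (r %| _)%N; last by rewrite (cardsD1 i) iin.
have [j /andP[ji ej]] : exists j, (j != i) && (e j != 0%N :> nat).
  apply/existsP; apply: contraTT re => /existsPn ez.
  rewrite (bigD1 i) //= big1 ?addn0 => [|j ji]; first by rewrite gtnNdvd ?lt0n.
  by have := ez j; rewrite negb_and ji negbK => /eqP.
rewrite (cardsD1 i) iin (cardsD1 j) !inE ji /=.
by rewrite ej.
Qed.

Lemma norm_kummer_sum_le e : e != e0 ->
  `|kummer_sum s z0 w (fun i => e i) + (r %| \sum_i e i)%N%:R|
    <= (weil_genus e)%:R * sqrtC q%:R.
Proof.
move=> /kummer_supp_ge; rewrite /weil_genus; case: (boolP (r %| _)%N) => re supp2.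
  rewrite subn2; apply: (kummer_weil_projective z0_prim cardF w_prim) => //.
  exact: leq_trans supp2.
rewrite addr0 subn1; exact: (kummer_weil z0_prim cardF w_prim).
Qed.

(** The supports total [(r - 1) r^r]; subtracted are the [r^r - 1] nontrivial [e] and, among them,
    the [r^(r-1) - 1] with divisible sum. *)
Lemma sum_weil_genus :
  (\sum_(e | e != e0) weil_genus e + 2 * r ^ r + r ^ r.-1 = r ^ r.+1 + 2)%N.
Proof.
have e0re : (r %| \sum_i e0 i)%N by rewrite big1 // => i _; rewrite ffunE.
have supp0 : #|[set i | e0 i != 0%N :> nat]| = 0%N.
  by apply/eqP; rewrite cards_eq0; apply/eqP/setP => i; rewrite !inE ffunE.
have rr : (r ^ r = r * r ^ r.-1)%N by rewrite -expnS prednK.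
have := sum_card_supp r_gt0; rewrite (bigD1 e0) //= supp0 add0n.
have := card_ffun_dvd r_gt0; rewrite cards_sum (bigD1 e0) //= e0re.
have : (1 + \sum_(e | e != e0) 1 = r ^ r)%N.
  have := sum1_card {ffun 'I_r -> 'I_r}.
  by rewrite (bigD1 e0) //= card_ffun !card_ord.
have -> : (\sum_(e | e != e0) #|[set i | e i != 0%N :> nat]|
   = \sum_(e | e != e0) weil_genus e + \sum_(e | e != e0) 1
     + \sum_(e | e != e0) (r %| \sum_j e j))%N.
  rewrite -addnA -!big_split /=; apply: eq_bigr => e /kummer_supp_ge supp_ge.
  by rewrite /weil_genus subnK.
move: (\sum_(e | e != e0) weil_genus e)%N (\sum_(e | e != e0) 1)%N
  (\sum_(e | e != e0) (r %| \sum_j e j))%N => x y u yE uE xyu.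
have : (r.-1 * (r * r ^ r.-1) + r * r ^ r.-1 = r * (r * r ^ r.-1))%N.
  by rewrite -mulSnr prednK.
have -> : (r ^ r.+1 = r * (r * r ^ r.-1))%N by rewrite expnS rr.
have : (r * (r.-1 * r ^ r.-1) = r.-1 * (r * r ^ r.-1))%N by rewrite mulnCA.
by rewrite -rr; lia.
Qed.

(* The number of rational places at infinity of that curve. *)
Definition pole_count : nat :=
  (r ^ r.-1 * #|[set u : 'I_r | [forall j : 'I_r, (r %| u + t j)%N]]|)%N.

Lemma pole_count_le : (pole_count <= r ^ r.-1)%N.
Proof.
rewrite /pole_count -[X in (_ <= X)%N]muln1 leq_mul2l; apply/orP; right.
apply/card_le1_eqP => u v; rewrite !inE => /forallP/(_ (Ordinal r_gt0)) ru.
move=> /forallP/(_ (Ordinal r_gt0)); move: ru; rewrite /dvdn => /eqP ru /eqP rv.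
have /eqP : (u + t (Ordinal r_gt0) = v + t (Ordinal r_gt0) %[mod r])%N.
  by rewrite ru rv.
by rewrite eqn_modDr !modn_small // => /eqP/val_inj.
Qed.

(** With the points at infinity added, the trivial character contributes exactly [q + 1]. *)
Lemma pattern_sum_char :
  (\sum_a \prod_j pattern_weight a j + pole_count)%N%:R - q.+1%:R
  = \sum_(e | e != e0) pattern_coef e *
      (kummer_sum s z0 w (fun i => e i) + (r %| \sum_i e i)%N%:R).
Proof.
have pole : pole_count%:R
    = \sum_(e : {ffun 'I_r -> 'I_r}) pattern_coef e * (r %| \sum_i e i)%N%:R.
  have rn0 : r%:R != 0 :> algC by rewrite pnatr_eq0 -lt0n.
  apply: (mulfI rn0); rewrite -natrM /pole_count mulnA -expnS prednK //.
  rewrite -(sum_ffun_dvd t w_prim) big_mkcond; congr (_ * _).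
  apply: eq_bigr => e _; case: ifP => _; rewrite ?mulr1 ?mulr0 //.
rewrite natrD pattern_weight_expand pole -big_split /= (bigD1 e0) //=.
have -> : pattern_coef e0 = 1.
  by rewrite /pattern_coef big1 // => j _; rewrite ffunE expr0.
rewrite big1 => [|i _]; last by rewrite ffunE.
rewrite dvdn0 kummer_sum_eq0 !mul1r -natr1 addrAC subrr add0r.
by apply: eq_bigr => e _; rewrite mulrDr.
Qed.

Lemma norm_pattern_sum :
  `|(\sum_a \prod_j pattern_weight a j + pole_count)%N%:R - q.+1%:R : algC|
    <= (\sum_(e | e != e0) weil_genus e)%N%:R * sqrtC q%:R.
Proof.
rewrite pattern_sum_char (le_trans (ler_norm_sum _ _ _)) // natr_sum mulr_suml.
apply: ler_sum => e ee0; rewrite normrM norm_pattern_coef mul1r.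
exact: norm_kummer_sum_le.
Qed.

End Complex.

(** Squaring makes the estimate one between integers, so it can pass from [algC] to any
    [realType]. *)
Lemma pattern_count G : (G + 2 * r ^ r + r ^ r.-1 = r ^ r.+1 + 2)%N ->
  exists X, [/\ (r ^ r * #|pattern_set| <= X)%N,
    (X <= r ^ r * #|pattern_set| + r * r ^ r.-1 + r ^ r.-1)%N
    & (X%:Z - q.+1%:Z) ^+ 2 <= (G ^ 2 * q)%N%:Z].
Proof.
move=> GE; exists (\sum_a \prod_j pattern_weight a j + pole_count)%N.
have /andP[lo hi] := sum_pattern_weight.
split; first by rewrite (leq_trans lo) ?leq_addr.
  by rewrite leq_add ?pole_count_le.
have [w wp] := C_prim_root_exists r_gt0.
have -> : G = (\sum_(e | e != e0) weil_genus e)%N.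
  apply: (@addIn (2 * r ^ r + r ^ r.-1)%N).
  by rewrite addnA GE -(sum_weil_genus wp) -addnA.
have := norm_pattern_sum wp; set X := (_ + _)%N; set g := (\sum_(e | _) _)%N.
move=> le_norm; rewrite -(ler_int algC) rmorphXn rmorphB /=.
have : `|X%:R - q.+1%:R : algC| ^+ 2 <= (g%:R * sqrtC q%:R) ^+ 2.
  by rewrite ler_pXn2r ?nnegrE ?mulr_ge0 ?sqrtC_ge0 ?ler0n.
rewrite real_normK ?realB ?realn // exprMn sqrtCK.
by rewrite -!pmulrn natrM natrX.
Qed.

End PatternCount.

(** * The permutation criterion *)

Section PermutationCriterion.

Variables (F : finFieldType) (r s k' n k : nat) (z0 : F).
Hypothesis z0_prim : (#|F|.-1).-primitive_root z0.
Hypothesis cardF : #|F| = (r * s).+1.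
Hypotheses (n_gt0 : (0 < n)%N) (kE : k = (s * k')%N).
Hypotheses (k'r : coprime k' r) (ns : coprime n s).
Local Notation q := #|F|.
Local Notation z := (z0 ^+ s).

(* Since gcd(n, s) = 1, f = x^n (x^k + a) permutes F iff y |-> y^n (y^k' + a)^s,
   which sends x^s to f(x)^s, permutes the r-th roots of unity. *)
Definition criterion (a : F) (pi : {perm 'I_r}) : bool :=
  [forall i : 'I_r, (z ^+ i) ^+ n * (z ^+ (i * k') + a) ^+ s == z ^+ pi i].

Let s_pos : (0 < s)%N := cofactor_gt0 cardF.
Let zp : r.-primitive_root z := node_prim z0_prim cardF.
Let r_gt0 : (0 < r)%N := prim_order_gt0 zp.

Lemma horner_binomial (a x : F) : (binomial_poly n k a).[x] = x ^+ n * (x ^+ k + a).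
Proof. by rewrite /binomial_poly hornerM hornerD !hornerXn hornerC. Qed.

Lemma exists_log (x : F) : x != 0 -> exists i : 'I_r, x ^+ s = z ^+ i.
Proof.
move=> x0; have [|[i ->]] := unity0P zp (unity0_exps cardF x).
  by move/eqP; rewrite expf_eq0 (negPf x0) andbF.
by exists (Ordinal (ltn_pmod i r_gt0)); rewrite /= prim_expr_mod.
Qed.

Lemma node_inj (i j : 'I_r) : z ^+ i = z ^+ j -> i = j.
Proof. exact: (kummer_node_inj z0_prim cardF). Qed.

Lemma horner_binomial_exps (a x : F) i : x ^+ s = z ^+ i ->
  (binomial_poly n k a).[x] ^+ s = (z ^+ i) ^+ n * (z ^+ (i * k') + a) ^+ s.
Proof.
move=> xs; rewrite horner_binomial exprMn [(x ^+ n) ^+ s]exprAC xs kE.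
by rewrite [x ^+ (s * _)]exprM xs -[(z ^+ i) ^+ k']exprM.
Qed.

Lemma criterion_sound a pi : criterion a pi -> permutes (binomial_poly n k a).
Proof.
move=> /forallP crit; apply: injF_bij => x y fxy.
have f0 : (binomial_poly n k a).[0] = 0.
  by rewrite horner_binomial expr0n gtn_eqF //= mul0r.
have fs t (i : 'I_r) : t ^+ s = z ^+ i -> (binomial_poly n k a).[t] ^+ s = z ^+ pi i.
  by move=> ts; rewrite (horner_binomial_exps _ ts) (eqP (crit i)).
have fn0 t : t != 0 -> (binomial_poly n k a).[t] != 0.
  move=> /exists_log[i ti]; have := fs t i ti.
  apply: contra_eqN => /eqP ->; rewrite expr0n gtn_eqF //= eq_sym.
  by rewrite expf_neq0 // (prim_root_neq0 zp).
have [x0|x0] := eqVneq x 0.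
  apply/eqP; rewrite x0 eq_sym; apply/negPn/negP => /fn0.
  by rewrite -fxy x0 f0 eqxx.
have y0 : y != 0.
  by apply: contraTneq (fn0 x x0) => y0; rewrite fxy y0 f0 negbK.
have [i xi] := exists_log x0; have [j yj] := exists_log y0.
have ij : i = j.
  by apply/(@perm_inj _ pi)/node_inj; rewrite -(fs x) // -(fs y) // fxy.
have xys : x ^+ s = y ^+ s by rewrite xi yj ij.
have xyk : x ^+ k = y ^+ k by rewrite kE !exprM xys.
have xyn : x ^+ n = y ^+ n.
  move: fxy (fn0 x x0); rewrite !horner_binomial xyk => fxy.
  by rewrite mulf_eq0 negb_or => /andP[_ yka]; apply: (mulIf yka).
(* [x ^+ n] and [x ^+ s] determine a nonzero [x], by the Bezout relation [u n = v s + 1]. *)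
have [u v uv _] := egcdnP s n_gt0; move: ns; rewrite /coprime => /eqP ns1.
rewrite ns1 in uv.
have E (t : F) : t ^+ (u * n) = t ^+ (v * s) * t by rewrite uv addn1 exprSr.
have := E x; have := E y; rewrite ![(u * _)%N]mulnC ![(v * _)%N]mulnC !exprM xyn xys.
by move=> -> eqm; apply/esym; apply: mulfI eqm; rewrite !expf_neq0.
Qed.

Lemma criterion_complete a :
  permutes (binomial_poly n k a) -> exists pi, criterion a pi.
Proof.
case=> g fK gK.
have f_inj : injective (fun x : F => (binomial_poly n k a).[x]) := can_inj fK.
have f0 : (binomial_poly n k a).[0] = 0.
  by rewrite horner_binomial expr0n gtn_eqF //= mul0r.
have z0j i : (z0 ^+ i) ^+ s = z ^+ i by rewrite -!exprM mulnC.
have fz0 i : (binomial_poly n k a).[z0 ^+ i] != 0.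
  by rewrite -f0 (inj_eq f_inj) expf_neq0 // (prim_root_neq0 z0_prim).
have ex (i : 'I_r) : exists j : 'I_r,
    (z ^+ i) ^+ n * (z ^+ (i * k') + a) ^+ s == z ^+ j.
  have [j jE] := exists_log (fz0 i); exists j.
  by rewrite -(horner_binomial_exps _ (z0j i)) jE.
pose p (i : 'I_r) : 'I_r := xchoose (ex i).
have pE (i : 'I_r) : (z ^+ i) ^+ n * (z ^+ (i * k') + a) ^+ s = z ^+ p i.
  exact/eqP/(xchooseP (ex i)).
(* The preimage of [z0 ^+ j] under the permutation supplies an index; on a finite set surjectivity
   is enough. *)
have p_surj (j : 'I_r) : exists i, p i = j.
  have gz0 : g (z0 ^+ j) != 0.
    apply: contraTneq (prim_root_neq0 z0_prim) => g0; apply/negPn.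
    have := gK (z0 ^+ j); rewrite g0 f0 => /esym/eqP.
    by rewrite expf_eq0 => /andP[].
  have [i iE] := exists_log gz0; exists i; apply: node_inj.
  by rewrite -pE -(horner_binomial_exps _ iE) gK z0j.
have p_inj : injective p.
  have [h hE] := fin_all_exists p_surj.
  by have := bij_can_bij (injF_bij (can_inj hE)) hE; apply: bij_inj.
exists (perm p_inj); apply/forallP => i; rewrite permE pE.
exact: eqxx.
Qed.

Lemma num_permuting_criterion :
  num_permuting F n k
  = (\sum_(pi : {perm 'I_r}) #|[set a | criterion a pi]|)%N.
Proof.
rewrite /num_permuting; under [RHS]eq_bigr do rewrite cards_sum.
rewrite cards_sum exchange_big /=; apply: eq_bigr => a _.
case: asboolP => [/criterion_complete[pi pia]|nperm]; last first.
  by rewrite big1 // => pi _; apply/eqP; rewrite eqb0; apply/negP => /criterion_sound.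
rewrite (bigD1 pi) //= pia big1 // => sigma sigma_pi; apply/eqP; rewrite eqb0.
apply: contra sigma_pi => sa; apply/eqP/permP => i; apply: node_inj.
by move/forallP: pia => /(_ i) /eqP <-; move/forallP: sa => /(_ i) /eqP <-.
Qed.

(** Since [k'] is prime to [r], the map [i |-> i k'] modulo [r] permutes the nodes; [r.-1 * pi i]
    encodes the inverse of [z ^+ pi i] with a natural exponent. *)
Lemma criterion_pattern (pi : {perm 'I_r}) :
  exists t : 'I_r -> nat, [set a | criterion a pi] = pattern_set s z0 t.
Proof.
pose kappa (i : 'I_r) : 'I_r := Ordinal (ltn_pmod (i * k') r_gt0).
have zk (i : 'I_r) : z ^+ kappa i = z ^+ (i * k') by rewrite /= prim_expr_mod.
have zkp : r.-primitive_root (z ^+ k') by rewrite prim_root_exp_coprime.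
have kappa_inj : injective kappa.
  move=> i j /(congr1 (fun x : 'I_r => z ^+ x)); rewrite /= !zk ![(_ * k')%N]mulnC.
  rewrite !exprM => /eqP; rewrite (eq_prim_root_expr zkp) !modn_small //.
  by move/eqP/val_inj.
exists (fun j => n * invF kappa_inj j + r.-1 * pi (invF kappa_inj j))%N.
apply/setP => a; rewrite !inE.
have step (i : 'I_r) : ((z ^+ i) ^+ n * (z ^+ (i * k') + a) ^+ s == z ^+ pi i)
    = ((z ^+ kappa i + a) ^+ s * z ^+ (n * i + r.-1 * pi i) == 1).
  have zpi0 : z ^+ pi i != 0 by rewrite expf_neq0 // (prim_root_neq0 zp).
  rewrite -[RHS](inj_eq (mulIf zpi0)) mul1r zk -mulrA -exprD -addnA -mulSnr.
  rewrite prednK // exprD [z ^+ (r * _)]exprM (prim_expr_order zp) expr1n mulr1.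
  by rewrite [X in X == _]mulrC [(n * i)%N]mulnC [z ^+ (i * n)]exprM.
apply/forallP/forallP => [crit j | pat i]; last first.
  by have := pat (kappa i); rewrite invF_f -step.
by have := crit (invF kappa_inj j); rewrite step f_invF.
Qed.

End PermutationCriterion.

Lemma sqr_bound_real (R : realType) (X q G : nat) :
  (X%:Z - q.+1%:Z) ^+ 2 <= (G ^ 2 * q)%N%:Z ->
  `|X%:R - (q%:R + 1) : R| <= Num.sqrt q%:R * G%:R.
Proof.
rewrite -(ler_int R) rmorphXn rmorphB /= -!pmulrn natrM natrX -natr1 => le2.
rewrite -(@ler_pXn2r _ 2) ?nnegrE ?mulr_ge0 ?sqrtr_ge0 ?ler0n //.
by rewrite real_normK ?num_real // exprMn sqr_sqrtr ?ler0n // mulrC.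
Qed.

Lemma exists_prim_root_finField (F : finFieldType) :
  exists z : F, #|F|.-1.-primitive_root z.
Proof.
have q_gt1 := card_finNzRing_gt1 F.
pose rs := [seq x <- index_enum F | x != 0].
have /hasP[z _ zp] : has #|F|.-1.-primitive_root rs; last by exists z.
apply: cyclic.has_prim_root.
- by rewrite -subn1 subn_gt0.
- apply/allP => x; rewrite mem_filter unity_rootE => /andP[x0 _].
  apply/eqP; apply: (mulIf x0).
  by rewrite -exprSr prednK ?(ltnW q_gt1) // expf_card mul1r.
- by rewrite filter_uniq // index_enum_uniq.
rewrite size_filter -sum1_count -(cardC1 (0 : F)) -sum1_card.
by rewrite leq_eqVlt; apply/orP; left; apply/eqP; apply: eq_bigl => x; rewrite !inE.
Qed.

Lemma num_permuting_bounds (R : realType) (F : finFieldType) (r s k' n k G : nat) :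
  #|F| = (r * s).+1 -> (0 < n)%N -> k = (s * k')%N -> (0 < r)%N ->
  coprime k' r -> coprime n s ->
  (G + 2 * r ^ r + r ^ r.-1 = r ^ r.+1 + 2)%N ->
  let T : R := (num_permuting F n k)%:R in
  r`!%:R * (#|F|%:R + 1 - Num.sqrt #|F|%:R * G%:R - (r%:R + 1) * r%:R ^+ r.-1)
    <= r%:R ^+ r * T
  /\ r%:R ^+ r * T <= r`!%:R * (#|F|%:R + 1 + Num.sqrt #|F|%:R * G%:R).
Proof.
move=> cardF n_gt0 kE r_gt0 k'r ns GE T.
have [z0 z0p] := exists_prim_root_finField F.
have fact_sum (b : R) : r`!%:R * b = \sum_(pi : {perm 'I_r}) b.
  rewrite sumr_const mulr_natl; congr (_ *+ _).
  by rewrite -(card_Sn r); apply: eq_card.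
have TE : r%:R ^+ r * T = \sum_(pi : {perm 'I_r})
    (r ^ r * #|[set a | criterion s k' n z0 a pi]|)%N%:R.
  rewrite /T (num_permuting_criterion z0p cardF n_gt0 kE ns).
  by rewrite natr_sum mulr_sumr; apply: eq_bigr => pi _; rewrite natrM natrX.
rewrite TE !fact_sum.
split; apply: ler_sum => pi _.
  have [t ->] := criterion_pattern n z0p cardF k'r pi.
  have [X [lo hi /(sqr_bound_real R)]] := pattern_count t z0p cardF GE.
  rewrite ler_norml => /andP[lb _].
  have : X%:R <= (r ^ r * #|pattern_set s z0 t| + r * r ^ r.-1 + r ^ r.-1)%N%:R :> R.
    by rewrite ler_nat.
  rewrite natrD natrD [(r * _)%N%:R]natrM natrX; move: lb; clear.
  by move: (_%:R ^+ _) (Num.sqrt _ * _) (_ * #|_|)%N%:R => *; lra.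
have [t ->] := criterion_pattern n z0p cardF k'r pi.
have [X [lo hi /(sqr_bound_real R)]] := pattern_count t z0p cardF GE.
rewrite ler_norml => /andP[_ ub].
apply: (@le_trans _ _ X%:R); first by rewrite ler_nat.
by rewrite -lerBlDl.
Qed.

(** * Small index *)

Section SmallIndex.

Variable R : realType.
Implicit Types x y : R.

Lemma ln_ge_subV x : 0 < x -> 1 - x^-1 <= ln x.
Proof.
move=> x0; have : ln (1 + (x^-1 - 1)) <= x^-1 - 1.
  by apply: le_ln1Dx; rewrite ltrBrDl subrr invr_gt0.
by rewrite addrC subrK lnV // lerNl opprB.
Qed.

(** Gives numerical lower bounds for [ln x] from a rational [a] slightly above 1. *)
Lemma ln_ge_of_exp m a x : 0 < a -> a ^+ m <= x -> m%:R * (1 - a^-1) <= ln x.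
Proof.
move=> a0 ax; have am : 0 < a ^+ m by rewrite exprn_gt0.
apply: (@le_trans _ _ (ln (a ^+ m))).
  by rewrite lnXn // -[ln a *+ m]mulr_natl ler_wpM2l ?ler0n // ln_ge_subV.
by rewrite ler_ln // posrE (lt_le_trans am).
Qed.

(** As [1 < r], [s] is at most [(q - 1) / 2], so [4 q ln L < (q - 1) L] for [L = ln q]. For [L <= 4]
    rational bounds on [L] refute this, with small [q] treated apart. *)
Lemma ln_gt4_of_index (q r s : nat) :
  q = (r * s).+1 -> (4 <= q)%N -> (1 < r)%N ->
  s%:R > 2 * q%:R * ln (ln q%:R) / ln q%:R :> R -> 4 < ln q%:R :> R.
Proof.
move=> qE q4 r1 hs; rewrite ltNge; apply/negP => L4.
have q4' : 4 <= q%:R :> R by rewrite (ler_nat R 4).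
have s_le : 2 * s%:R <= q%:R - 1 :> R.
  by rewrite lerBrDr -(natrM R 2) natr1 ler_nat qE ltnS leq_mul2r r1 orbT.
set L : R := ln q%:R in hs L4.
have L1 : 6 / 5 <= L.
  have -> : 6 / 5 = 6%:R * (1 - (5 / 4)^-1) :> R by field.
  by apply: ln_ge_of_exp; lra.
have L0 : 0 < L by lra.
move: hs; rewrite ltr_pdivrMr // => hs.
have hs' : 4 * q%:R * ln L < (q%:R - 1) * L.
  have := ler_wpM2r (ltW L0) s_le; lra.
have lnL : L - 1 <= L * ln L.
  have := ler_wpM2l (ltW L0) (ln_ge_subV L0).
  by rewrite mulrBr mulfV ?mulr1 // gt_eqF.
(* For [q = 4] integrality sharpens the bound to [s <= 1], and then [6 / 5 <= L] suffices. *)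
case: (ltnP q 5) => [q_lt|q5].
  have qq : q = 4%N by clear -q_lt q4; lia.
  have s1 : (s <= 1)%N by rewrite leqNgt; apply/negP => s2; clear -s2 qE r1 qq; nia.
  have {}s1 : s%:R <= 1 :> R by rewrite (ler_nat R s 1).
  rewrite qq in hs.
  have h8 : 8 * ln L < L by have := ler_wpM2r (ltW L0) s1; lra.
  have : L * (8 * ln L) < L * L by rewrite ltr_pM2l.
  by clear -lnL L1 L4; nra.
have q0 : 0 <= q%:R :> R by rewrite ler0n.
have hs2 : 4 * q%:R * (L - 1) < (q%:R - 1) * L ^+ 2.
  have h1 : 4 * q%:R * (L - 1) <= 4 * q%:R * (L * ln L).
    by rewrite ler_wpM2l // mulr_ge0.
  apply: le_lt_trans h1 _.
  have : L * (4 * q%:R * ln L) < L * ((q%:R - 1) * L) by rewrite ltr_pM2l.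
  lra.
case: (ltnP q 7) => [q_lt|q7].
  have L2 : 13 / 9 <= L.
    have -> : 13 / 9 = 13%:R * (1 - (9 / 8)^-1) :> R by field.
    apply: ln_ge_of_exp; first by lra.
    have : 5 <= q%:R :> R by rewrite (ler_nat R 5).
    lra.
  have L3 : L <= 3.
    apply: (@le_trans _ _ (ln (2 ^+ 3))).
      rewrite ler_ln ?posrE ?ltr0n ?exprn_gt0 ?(ltr0n R 2) //; last by exact: ltn_trans q4.
      by rewrite -natrX (ler_nat R) (leq_trans (ltnW q_lt)).
    rewrite lnXn ?(ltr0n R 2) //.
    have := @le_ln1Dx R 1; rewrite -[1 + 1]/2%:R; have : -1 < 1 :> R by lra.
    by move=> h /(_ h); lra.
  have [qq|qq] : q = 5%N \/ q = 6%N by clear -q5 q_lt; lia.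
    by rewrite qq in hs2; clear -hs2 L2 L3; nra.
  by rewrite qq in hs2; clear -hs2 L2 L3; nra.
have L2 : 8 / 5 <= L.
  have -> : 8 / 5 = 8%:R * (1 - (5 / 4)^-1) :> R by field.
  apply: ln_ge_of_exp; first by lra.
  have : 7 <= q%:R :> R by rewrite (ler_nat R 7).
  lra.
(* The sharper [ln L >= 2 (1 - 1 / y)] turns [4 ln L < L] into [(2 - y) (y^2 + 2 y - 4) < 0], false
   for [126 / 100 <= y <= 2]; the root [y = 2] is the threshold [L = 4]. *)
pose y := Num.sqrt L; have yL : y ^+ 2 = L by rewrite sqr_sqrtr ?ltW.
have y0 : 0 < y by rewrite sqrtr_gt0.
have lny : y * ln L >= 2 * (y - 1).
  rewrite -yL lnXn // -[ln y *+ 2]mulr_natl mulrCA ler_wpM2l //.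
  have := ler_wpM2l (ltW y0) (ln_ge_subV y0).
  by rewrite mulrBr mulfV ?mulr1 // gt_eqF.
have h4 : 4 * ln L < L.
  have q_gt0 : 0 < q%:R :> R by rewrite ltr0n (leq_trans _ q4).
  rewrite -(ltr_pM2l q_gt0); lra.
have : y * (4 * ln L) < y * L by rewrite ltr_pM2l.
have y2 : y <= 2 by clear -yL y0 L4; nra.
have y1 : 126 / 100 <= y by clear -yL y0 L2; nra.
have p1 : 0 < y ^+ 2 + 2 * y - 4 by clear -yL y1 L2; nra.
have p2 : 0 <= (2 - y) * (y ^+ 2 + 2 * y - 4).
  by apply: mulr_ge0; [rewrite subr_ge0 | apply: ltW].
by clear -lny yL p2; nra.
Qed.

(** [4 < L] gives [ln L >= 1], so [2 r ln L < L] yields [2 r <= L]; then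
    [(2 r)^(2 r) <= L^(2 r) < e^L = q]. *)
Lemma sqr_index_lt (q r s : nat) :
  q = (r * s).+1 -> (0 < r)%N -> 4 < ln q%:R :> R ->
  s%:R > 2 * q%:R * ln (ln q%:R) / ln q%:R :> R -> (((2 * r) ^ r) ^ 2 < q)%N.
Proof.
move=> qE r0; have q0 : 0 < q%:R :> R by rewrite ltr0n qE.
set L : R := ln q%:R => L4 hs; have L0 : 0 < L by lra.
have lnL1 : 1 <= ln L.
  apply: (@le_trans _ _ (6%:R * (1 - (5 / 4)^-1))).
    have -> : 6%:R * (1 - (5 / 4)^-1) = 6 / 5 :> R by field.
    by lra.
  by apply: ln_ge_of_exp; lra.
have r0' : 0 < r%:R :> R by rewrite ltr0n.
have rs : r%:R * s%:R < q%:R :> R by rewrite -natrM ltr_nat qE.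
move: hs; rewrite ltr_pdivrMr // => hs.
have rL : (2 * r)%N%:R * ln L < L.
  rewrite natrM -(ltr_pM2l q0).
  have h1 := ltr_pM2l r0' (2 * q%:R * ln L) (s%:R * L); rewrite hs in h1.
  have h2 := ltr_pM2r L0 (r%:R * s%:R) q%:R; rewrite rs in h2.
  by clear -h1 h2; lra.
have r2L : (2 * r)%N%:R <= L.
  by apply: le_trans (ltW rL); rewrite -[X in X <= _]mulr1 ler_wpM2l ?ler0n.
rewrite -expnM mulnC -(ltr_nat R) natrX [(r * 2)%N]mulnC.
apply: le_lt_trans (_ : L ^+ (2 * r) < _).
  by rewrite lerXn2r ?nnegrE ?ler0n ?(ltW L0).
have -> : L = sequences.expR (ln L) by rewrite lnK.
rewrite -expRM_natl; have -> : q%:R = sequences.expR L by rewrite lnK.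
by rewrite ltr_expR.
Qed.

End SmallIndex.

(* The constant G of the theorem, written additively to avoid truncated
   subtraction in nat. *)
Lemma weil_constant_nat (r : nat) : (0 < r)%N ->
  exists G, (G + 2 * r ^ r + r ^ r.-1 = r ^ r.+1 + 2)%N.
Proof.
move=> r0; exists (r ^ r.+1 + 2 - (2 * r ^ r + r ^ r.-1))%N.
rewrite -addnA subnK //; have rr : (r ^ r = r * r ^ r.-1)%N by rewrite -expnS prednK.
have p0 : (0 < r ^ r.-1)%N by rewrite expn_gt0 r0.
case: (r) r0 rr p0 => [|[|[|r']]] // _ rr p0; rewrite [(_ ^ _.+4)%N]expnS.
have : (r'.+3 ^ r'.+3.-1 <= r'.+3 ^ r'.+3)%N by rewrite leq_pexp2l.
by nia.
Qed.

(** Here [sqrt q > (2 r)^r >= 2 r^(r+1) >= 2 G], so the error term takes at most half of [q], and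
    the other half dominates the rest. *)
Lemma index_bound (R : realType) (q r G : nat) : (1 < r)%N ->
  (G + 2 * r ^ r + r ^ r.-1 = r ^ r.+1 + 2)%N -> (((2 * r) ^ r) ^ 2 < q)%N ->
  r%:R ^+ r < r`!%:R * (q%:R + 1 - Num.sqrt q%:R * G%:R
                        - (r%:R + 1) * r%:R ^+ r.-1) :> R.
Proof.
move=> r1 GE ltq; have r_gt0 : (0 < r)%N by apply: ltnW.
pose A : R := (2 * r%:R) ^+ r; pose y : R := Num.sqrt q%:R.
have yq : y ^+ 2 = q%:R by rewrite sqr_sqrtr ?ler0n.
have y0 : 0 <= y by rewrite sqrtr_ge0.
have Ay : A < y.
  rewrite -(@ltr_pXn2r _ 2) ?nnegrE ?exprn_ge0 ?mulr_ge0 ?ler0n // yq.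
  by rewrite /A -(natrM R 2) -!natrX ltr_nat.
pose P : R := r%:R ^+ r; pose P1 : R := r%:R ^+ r.-1.
have PE : P = r%:R * P1 by rewrite /P /P1 -exprS prednK.
have P1_ge1 : 1 <= P1 by rewrite /P1 -natrX (ler_nat R 1) expn_gt0 r_gt0.
have r2 : 2 <= r%:R :> R by rewrite (ler_nat R 2).
have A2 : 2 * (r%:R * P) <= A.
  rewrite /A exprMn -/P mulrA ler_wpM2r ?exprn_ge0 ?ler0n // -(natrM R 2) -natrX.
  rewrite ler_nat -[in X in (_ <= X)%N](prednK r_gt0) expnS leq_mul2l /=.
  by rewrite -{1}(prednK r_gt0) ltn_expl.
have GP : G%:R <= r%:R * P.
  have := congr1 (fun m : nat => m%:R : R) GE.
  have P_ge1 : 1 <= P by rewrite /P -natrX (ler_nat R 1) expn_gt0 r_gt0.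
  rewrite /= natrD [(G + _)%N%:R]natrD [(2 * _)%N%:R]natrM [(_ + 2)%N%:R]natrD !natrX.
  rewrite exprS -/P -/P1; clear -P_ge1 P1_ge1; lra.
have yG : y * G%:R <= y * (y / 2).
  by rewrite ler_wpM2l //; clear -GP A2 Ay; lra.
have E_gt : P < q%:R + 1 - y * G%:R - (r%:R + 1) * P1.
  rewrite -yq; clear -yG A2 Ay PE P1_ge1 r2 y0.
  have h1 : (r%:R + 1) * P1 <= 2 * P by nra.
  have h2 : 2 * P <= r%:R * P by nra.
  by nra.
apply: (lt_le_trans E_gt); rewrite ler_peMl //.
  by apply: ltW; apply: le_lt_trans E_gt; rewrite exprn_ge0 ?ler0n.
by rewrite (ler_nat R 1) fact_gt0.
Qed.

Lemma index_bound_eq1 (R : realType) (q r G : nat) : r = 1%N -> (3 < q)%N ->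
  (G + 2 * r ^ r + r ^ r.-1 = r ^ r.+1 + 2)%N ->
  r%:R ^+ r < r`!%:R * (q%:R + 1 - Num.sqrt q%:R * G%:R
                        - (r%:R + 1) * r%:R ^+ r.-1) :> R.
Proof.
move=> -> q_gt3; rewrite !exp1n addn1 muln1 => GE.
have -> : G = 0%N by lia.
have : 4 <= q%:R :> R by rewrite (ler_nat R 4).
by rewrite expr1 expr0 (_ : 1`! = 1%N) // mulr0 mul1r mulr1 subr0; clear; lra.
Qed.

Theorem theorem3p1 (R : realType) (q : nat) (F : finFieldType) (n k : nat)
    (hF : #|F| = q) (hq : (4 <= q)%N) (hn : (0 < n)%N) (hk : (0 < k)%N)
    (hgcd : gcdn n (gcdn k (q - 1)) = 1%N) :
  ((gcdn k (q - 1))%:R > 2 * q%:R * ln (ln (q%:R : R)) / ln (q%:R : R) ->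
     exists a : F, a != 0 /\ permutes (binomial_poly n k a))
  /\
  (let r : nat := ((q - 1) %/ gcdn k (q - 1))%N in
   let T : R := (num_permuting F n k)%:R in
   let c : R := r`!%:R / r%:R ^+ r in
   let G : R :=
     r%:R ^+ (r + 1) - 2 * r%:R ^+ r - r%:R ^+ (r - 1) + 2 in
   c * (q%:R + 1 - Num.sqrt q%:R * G - (r%:R + 1) * r%:R ^+ (r - 1)) <= T
   /\ T <= c * (q%:R + 1 + Num.sqrt q%:R * G)).
Proof.
set s := gcdn k (q - 1); set r := ((q - 1) %/ s)%N.
have q1_gt0 : (0 < q - 1)%N by rewrite subn_gt0 (leq_trans _ hq).
have s_gt0 : (0 < s)%N by rewrite gcdn_gt0 hk.
have rs : (r * s = q - 1)%N by rewrite divnK // dvdn_gcdr.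
have qE : q = (r * s).+1 by rewrite rs subn1 prednK // (leq_trans _ hq).
have r_gt0 : (0 < r)%N by move: q1_gt0; rewrite -rs muln_gt0 => /andP[].
have kE : k = (s * (k %/ s))%N by rewrite mulnC divnK // dvdn_gcdl.
have k'r : coprime (k %/ s) r.
  by rewrite /coprime -(eqn_pmul2r s_gt0) muln_gcdl rs mulnC -kE mul1n.
have ns : coprime n s by apply/eqP.
have [G GE] := weil_constant_nat r_gt0.
have cardF : #|F| = (r * s).+1 by rewrite hF.
have := num_permuting_bounds R cardF hn kE r_gt0 k'r ns GE.
rewrite hF => -[lo hi].
have rr0 : 0 < r%:R ^+ r :> R by rewrite exprn_gt0 // ltr0n.
split.
  move=> hs; pose A := [set a : F | `[< permutes (binomial_poly n k a) >]].
  suff /card_gt0P[a] : (0 < #|A :\ 0%R|)%N.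
    by rewrite !inE => /andP[a0 /asboolP pa]; exists a.
  have : (1 < num_permuting F n k)%N.
    rewrite -(ltr_nat R) -(ltr_pM2l rr0) mulr1; apply: lt_le_trans lo.
    have [r1|r2] : r = 1%N \/ (1 < r)%N.
      by move: r_gt0; rewrite leq_eqVlt => /orP[/eqP <-|]; [left | right].
      exact: index_bound_eq1 r1 hq GE.
    have L4 := ln_gt4_of_index qE hq r2 hs.
    have := sqr_index_lt qE r_gt0 L4 hs.
    exact: index_bound r2 GE.
  rewrite /num_permuting -/A (cardsD1 0%R); case: (_ \in _) => /= [|/ltnW //].
  by rewrite add1n ltnS.
rewrite /=; have -> : r%:R ^+ (r + 1) - 2 * r%:R ^+ r - r%:R ^+ (r - 1) + 2 = G%:R :> R.
  have := congr1 (fun m : nat => m%:R : R) GE.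
  rewrite /= natrD [(G + _)%N%:R]natrD [(2 * _)%N%:R]natrM [(_ + 2)%N%:R]natrD !natrX.
  by rewrite addn1 subn1; clear; lra.
rewrite subn1; split.
  by rewrite mulrAC ler_pdivrMr // [_ * r%:R ^+ r]mulrC.
by rewrite mulrAC ler_pdivlMr // [_ * r%:R ^+ r]mulrC.
Qed.
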